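(* (1) $\mathrm{PRT}\subset\mathrm{PRT[O]}\subset\mathrm{PRT[T,O]}$; (2) $\mathrm{PRT}\subset\mathrm{PRT[T]}\subset\mathrm{PRT[T,O]}$; (3) $\mathrm{PRT[O]}\setminus\mathrm{PRT[T]}\neq\emptyset$; (4) $\mathrm{PRT[T]}\setminus\mathrm{PRT[O]}\neq\emptyset$. Here $\subset$ denotes proper inclusion.
   Context: An indexed family is a sequence $\mathcal F=(F_n)_{n\in\mathbb N}$ of subsets of $\mathbb N$ that is uniformly computably enumerable; $F\in\mathcal F$ means $F=F_n$ for some $n$, and $\mathrm{mi}_{\mathcal F}(F)$ is the least $n$ with $F_n=F$. An enumeration of a nonempty set $A$ is an infinite sequence of elements of $A$ in which every element of $A$ occurs; $f\restriction n$ is its initial segment of length $n$, and $\mathrm{content}(\sigma)$ is the set of entries of a finite string $\sigma$. A learner is a partial computable function from finite strings of naturals to naturals; hypothesis $h$ is interpreted as $F_h$. $M$ converges to a correct index on an enumeration $f$ of $F$ if there is $i$ with $M(f\restriction j)=M(f\restriction i)$ for all $j\ge i$ and $F_{M(f\restriction i)}=F$. $\mathcal F$ is PRT-learnable if there are a learner $M$ and a polynomial $p$ such that for every $F\in\mathcal F$ and every enumeration $f$ of $F$, $M$ converges to a correct index on $f$ in fewer than $p(\mathrm{mi}_{\mathcal F}(F))$ computation steps, with the number of oracle queries (if an oracle is used) also bounded by $p(\mathrm{mi}_{\mathcal F}(F))$. A teacher is a computable map $T$ on finite strings with $T(\sigma)$ a prefix of $T(\tau)$ whenever $\sigma$ is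 a prefix of $\tau$, and $\mathrm{content}(T(\sigma))\subseteq\mathrm{content}(\sigma)$. PRT[O]-learnable: some learner with a membership oracle for the target set PRT-learns $\mathcal F$. PRT[T]-learnable: there is a learner-teacher pair $(M,T)$ such that $M$, fed $T(f\restriction n)$ in place of $f\restriction n$, meets the PRT criterion for every enumeration $f$ of every member of $\mathcal F$, counting only the learner's computation. PRT[T,O]-learnable: as for PRT[T], but $M$ additionally has a membership oracle for the target and $T$ has access to the oracle answers $M$ receives. PRT, PRT[O], PRT[T], PRT[T,O] denote the corresponding classes of indexed families. *)

(* Defs.v *)
From mathcomp Require Import all_boot.

Set Implicit Arguments.
Unset Strict Implicit.
Unset Printing Implicit Defensive.

Inductive sym : Type := Bl | Zero | One | Hash.

Definition sym_eqb (a b : sym) : bool :=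
  match a, b with
  | Bl, Bl | Zero, Zero | One, One | Hash, Hash => true
  | _, _ => false
  end.

Inductive dir : Type := Lft | Rgt | Stay.

(* An action of the finite control: write a symbol, move, go to a state;
   or query the oracle about the number written in binary at the head
   (MSB first, read rightwards) and branch on the answer. *)
Inductive action : Type :=
  | Wr (s : sym) (d : dir) (q : nat)
  | Ask (qyes qno : nat).

(* A machine is a finite transition table; state 0 is the start state; a
   configuration (state, scanned symbol) with no entry is halting. *)
Definition TM := seq (nat * sym * action).

Fixpoint lookup (M : TM) (q : nat) (s : sym) : option action :=
  match M with
  | [::] => None
  | (q', s', a) :: M' => if (q' == q) && sym_eqb s' s then Some a else lookup M' q s
  end.

Definition oracle_free (M : TM) : Prop :=
  forall q s qy qn, lookup M q s <> Some (Ask qy qn).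

Fixpoint readnum (acc : nat) (t : seq sym) : nat :=
  match t with
  | Zero :: t' => readnum acc.*2 t'
  | One :: t' => readnum acc.*2.+1 t'
  | _ => acc
  end.

Fixpoint lsb_bits (fuel n : nat) : seq sym :=
  match fuel with
  | 0 => [::]
  | fuel'.+1 => if n == 0 then [::]
                else (if odd n then One else Zero) :: lsb_bits fuel' n./2
  end.

Definition bin (n : nat) : seq sym :=
  if n == 0 then [:: Zero] else rev (lsb_bits n n).

Definition enc (s : seq nat) : seq sym :=
  flatten [seq bin x ++ [:: Hash] | x <- s].

Definition move (d : dir) (l : seq sym) (h : sym) (r : seq sym)
  : seq sym * sym * seq sym :=
  match d with
  | Stay => (l, h, r)
  | Lft => match l with
           | [::] => ([::], Bl, h :: r)
           | x :: l' => (l', x, h :: r)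
           end
  | Rgt => match r with
           | [::] => (h :: l, Bl, [::])
           | x :: r' => (h :: l, x, r')
           end
  end.

Fixpoint exec (M : TM) (o : nat -> bool) (fuel q : nat) (l : seq sym) (h : sym)
  (r : seq sym) (t : nat) (tr : seq (nat * bool))
  : option (seq sym * nat * seq (nat * bool)) :=
  match lookup M q h with
  | None => Some (h :: r, t, tr)
  | Some a =>
      match fuel with
      | 0 => None
      | fuel'.+1 =>
          match a with
          | Wr s d q' =>
              let: (l', h', r') := move d l s r in
              exec M o fuel' q' l' h' r' t.+1 tr
          | Ask qy qn =>
              let x := readnum 0 (h :: r) in
              let b := o x in
              exec M o fuel' (if b then qy else qn) l h r t.+1 (rcons tr (x, b))
          end
      end
  end.

Definition run_tape (M : TM) (o : nat -> bool) (s : seq nat)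
  (tape : seq sym) (t : nat) (tr : seq (nat * bool)) : Prop :=
  exists fuel,
    exec M o fuel 0 [::] (head Bl (enc s)) (behead (enc s)) 0 [::]
    = Some (tape, t, tr).

Definition res (M : TM) (o : nat -> bool) (s : seq nat) (out t : nat)
  (tr : seq (nat * bool)) : Prop :=
  exists tape, run_tape M o s tape t tr /\ readnum 0 tape = out.

Definition res_seq (M : TM) (s : seq nat) (tau : seq nat) : Prop :=
  exists tape t tr rest, run_tape M (fun _ => false) s tape t tr /\
    tape ++ [:: Bl] = enc tau ++ Bl :: rest.

Definition halts (M : TM) (s : seq nat) : Prop :=
  exists out t tr, res M (fun _ => false) s out t tr.

Definition same (A B : nat -> Prop) : Prop := forall x, A x <-> B x.

Definition indexed_family (F : nat -> nat -> Prop) : Prop :=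
  exists E : TM, oracle_free E /\ forall n x, F n x <-> halts E [:: n; x].

Definition min_index (F : nat -> nat -> Prop) (k : nat) : Prop :=
  forall j, j < k -> ~ same (F j) (F k).

Definition is_enum (f : nat -> nat) (A : nat -> Prop) : Prop :=
  (forall n, A (f n)) /\ (forall x, A x -> exists n, f n = x).

Definition iseg (f : nat -> nat) (n : nat) : seq nat := mkseq f n.

Definition oracle_for (o : nat -> bool) (A : nat -> Prop) : Prop :=
  forall q, o q = true <-> A q.

Definition peval (p : seq nat) (n : nat) : nat := foldr (fun c acc => c + n * acc) 0 p.

Definition conv_within (M : TM) (o : nat -> bool) (F : nat -> nat -> Prop)
  (A : nat -> Prop) (D : nat -> seq nat) (b : nat) : Prop :=
  exists (i h : nat) (ts qs : nat -> nat),
    same (F h) A /\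
    (forall j, j <= i -> exists out tr, res M o (D j) out (ts j) tr /\ qs j = size tr) /\
    (forall j, i <= j -> exists t tr, res M o (D j) h t tr) /\
    \sum_(j < i.+1) ts j < b /\ \sum_(j < i.+1) qs j < b.

Definition no_oracle : nat -> bool := fun _ => false.

Definition teacher (T : TM) : Prop :=
  oracle_free T /\
  (forall s, exists tau, res_seq T s tau) /\
  (forall s s' tau tau', res_seq T s tau -> res_seq T s' tau' ->
     prefix s s' -> prefix tau tau') /\
  (forall s tau, res_seq T s tau -> {subset tau <= s}).

(* A teacher with access to the oracle transcript: its input is the data
   string s together with the list tr of (query, answer) pairs received by the
   learner so far, coded as a single string of naturals. *)
Definition code_st (s : seq nat) (tr : seq (nat * bool)) : seq nat :=
  size s :: s ++ flatten [seq [:: x.1; nat_of_bool x.2] | x <- tr].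

Definition teachO (T : TM) (s : seq nat) (tr : seq (nat * bool)) (tau : seq nat) :=
  res_seq T (code_st s tr) tau.

Definition teacherO (T : TM) : Prop :=
  oracle_free T /\
  (forall s tr, exists tau, teachO T s tr tau) /\
  (forall s s' tr tr' tau tau', teachO T s tr tau -> teachO T s' tr' tau' ->
     prefix s s' -> prefix tr tr' -> prefix tau tau') /\
  (forall s tr tau, teachO T s tr tau -> {subset tau <= s}).

Definition PRT (F : nat -> nat -> Prop) : Prop :=
  exists (M : TM) (p : seq nat), oracle_free M /\
    forall k, min_index F k -> forall f, is_enum f (F k) ->
      conv_within M no_oracle F (F k) (iseg f) (peval p k).

Definition PRT_O (F : nat -> nat -> Prop) : Prop :=
  exists (M : TM) (p : seq nat),
    forall k, min_index F k -> forall f, is_enum f (F k) ->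
    forall o, oracle_for o (F k) ->
      conv_within M o F (F k) (iseg f) (peval p k).

Definition PRT_T (F : nat -> nat -> Prop) : Prop :=
  exists (M T : TM) (p : seq nat), oracle_free M /\ teacher T /\
    forall k, min_index F k -> forall f, is_enum f (F k) ->
      exists D : nat -> seq nat, (forall n, res_seq T (iseg f n) (D n)) /\
        conv_within M no_oracle F (F k) D (peval p k).

Definition PRT_TO (F : nat -> nat -> Prop) : Prop :=
  exists (M T : TM) (p : seq nat), teacherO T /\
    forall k, min_index F k -> forall f, is_enum f (F k) ->
    forall o, oracle_for o (F k) ->
      exists (D : nat -> seq nat) (Tr : nat -> seq (nat * bool)),
        Tr 0 = [::] /\
        (forall n, teachO T (iseg f n) (Tr n) (D n) /\
           exists out t tr, res M o (D n) out t tr /\ Tr n.+1 = Tr n ++ tr) /\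
        conv_within M o F (F k) D (peval p k).

Definition strict_incl (C1 C2 : (nat -> nat -> Prop) -> Prop) : Prop :=
  (forall F, indexed_family F -> C1 F -> C2 F) /\
  (exists F, indexed_family F /\ C2 F /\ ~ C1 F).

Definition not_incl (C1 C2 : (nat -> nat -> Prop) -> Prop) : Prop :=
  exists F, indexed_family F /\ C1 F /\ ~ C2 F.

(* Main.v *)
Require Import Defs.
From HB Require Import structures.
From Stdlib Require Import Classical ClassicalEpsilon.
From mathcomp Require Import all_boot zify.

Set Implicit Arguments.
Unset Strict Implicit.
Unset Printing Implicit Defensive.

(** Two families give all the separations.

    [F_run] contains [nat] and, for every [m > 0], at the index with binary
    expansion [1^m], the set of numbers whose expansion starts with fewer than [m]
    ones.  No finite set of data separates [nat] from the others, so by Gold's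
    argument [F_run] is not even learnable in the limit from positive data, and a
    teacher, being a function of the data, does not help.  With queries one asks
    for [1], [11], [111], ... until the first negative answer, which is an index of
    the target.

    [F_pad] contains [{0}] and, at the index [n = 1^m], the set of [0] and of all
    [1^m 0^L] with [L >= 2^(2n)].  A teacher can wait for the first nonzero number,
    whose leading bits spell an index.  Without a teacher, an enumeration may
    start with more than [p n] zeros; in [p n] steps the learner writes
    down only numbers too short to be nonzero members, so it behaves as on the
    target [{0}], on which its hypotheses are bounded.

    For the inclusions into PRT[T,O], the data string has to be extracted from its
    code together with the transcript by an actual machine, which is then followed
    by the given teacher. *)

Lemma sym_eqP : Equality.axiom sym_eqb.
Proof. by case; case; constructor. Qed.

HB.instance Definition _ := hasDecEq.Build sym sym_eqP.

(** * Binary numerals *)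

Definition is_bit (s : sym) : bool := (s == Zero) || (s == One).
Definition bit (b : bool) : sym := if b then One else Zero.

Lemma lsb_bits_fuel f n : n <= f -> lsb_bits f n = lsb_bits n n.
Proof.
suff H : forall f g n, n <= f -> n <= g -> lsb_bits f n = lsb_bits g n.
  by move=> le_nf; apply: H.
elim=> [|f' IH] g [|k] //=; try by case: g.
by case: g => [//|g] le1 le2; rewrite /= (IH g) //; lia.
Qed.

Lemma lsb_bitsS n : 0 < n -> lsb_bits n n = bit (odd n) :: lsb_bits n./2 n./2.
Proof.
case: n => // n _; have -> : lsb_bits n.+1 n.+1 = bit (odd n.+1) :: lsb_bits n n.+1./2 by [].
by rewrite lsb_bits_fuel //; lia.
Qed.

Lemma bin_double (b : bool) x : 0 < x -> bin (b + x.*2) = rcons (bin x) (bit b).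
Proof.
move=> x_gt0; rewrite /bin.
have -> : (b + x.*2 == 0) = false by lia.
have -> : (x == 0) = false by lia.
rewrite lsb_bitsS; last by lia.
by rewrite half_bit_double rev_cons oddD odd_double addbF oddb.
Qed.

(** Induction along [bin_double]: a positive number grows by one least significant digit, at the
    right end of its expansion. *)
Lemma bin_ind (P : nat -> Prop) :
  P 0 -> P 1 -> (forall (b : bool) x, 0 < x -> P x -> P (b + x.*2)) -> forall x, P x.
Proof.
move=> P0 P1 PS; elim/ltn_ind=> -[//|[//|x]] IH.
rewrite -[x.+2]odd_double_half; apply: PS; first by lia.
by apply: IH; lia.
Qed.

Lemma bin_bits x : all is_bit (bin x).
Proof.
elim/bin_ind: x => // b x x_gt0 IH.
by rewrite bin_double // all_rcons IH; case: b.
Qed.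

Lemma bin_pos x : 0 < x -> exists w, bin x = One :: w.
Proof.
elim/bin_ind: x => // [_|b x x_gt0 IH _]; first by exists [::].
by case: (IH x_gt0) => w E; rewrite bin_double // E; exists (rcons w (bit b)).
Qed.

Lemma readnum_rcons acc w (b : bool) :
  all is_bit w -> readnum acc (rcons w (bit b)) = b + (readnum acc w).*2.
Proof.
elim: w acc => [|s w IH] acc /=; first by case: b.
by case: s => //= wb; rewrite IH.
Qed.

Lemma readnum_stop acc w s u : ~~ is_bit s -> all is_bit w ->
  readnum acc (w ++ s :: u) = readnum acc w.
Proof.
by move=> ns; elim: w acc => [|[] w IH] acc //=; [case: s ns|apply: IH|apply: IH].
Qed.

Lemma bin_readnumK x : readnum 0 (bin x) = x.
Proof.
elim/bin_ind: x => // b x x_gt0 IH.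
by rewrite bin_double // readnum_rcons ?bin_bits // IH.
Qed.

Lemma bin_inj : injective bin.
Proof. by move=> x y E; rewrite -[x]bin_readnumK E bin_readnumK. Qed.

Lemma readnum_One_gt0 w : 0 < readnum 0 (One :: w).
Proof.
suff H acc : 0 < acc -> 0 < readnum acc w by apply: H.
by elim: w acc => [|[] w IH] acc //= a0; apply: IH; lia.
Qed.

Lemma readnumK w : all is_bit w -> bin (readnum 0 (One :: w)) = One :: w.
Proof.
elim/last_ind: w => [//|w s IH]; rewrite all_rcons => /andP[sb wb].
have [b ->] : exists b, s = bit b by case: s sb => // _; [exists false|exists true].
rewrite -rcons_cons readnum_rcons; last by rewrite /= wb.
by rewrite bin_double ?readnum_One_gt0 // IH.
Qed.

Lemma readnum_zeros acc n : readnum acc (nseq n Zero) = acc * 2 ^ n.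
Proof.
elim: n acc => [|n IH] acc; first by rewrite muln1.
by rewrite /= IH expnS; lia.
Qed.

Lemma readnum_ones n : (readnum 0 (nseq n One)).+1 = 2 ^ n.
Proof.
suff H acc : (readnum acc (nseq n One)).+1 = acc.+1 * 2 ^ n by rewrite H mul1n.
by elim: n acc => [|n IH] acc; rewrite ?muln1 //= IH expnS; lia.
Qed.

Lemma readnum_ub w acc : readnum acc w < acc.+1 * 2 ^ size w.
Proof.
elim: w acc => [|s w IH] acc; first by rewrite muln1.
have p := expn_gt0 2 (size w).
by case: s => /=; rewrite expnS; [|have := IH acc.*2|have := IH acc.*2.+1|]; nia.
Qed.

Lemma bin_ones m : 0 < m -> bin (readnum 0 (nseq m One)) = nseq m One.
Proof. by case: m => // m _; apply: readnumK; rewrite all_nseq orbT. Qed.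

Lemma enc_cons x s : enc (x :: s) = bin x ++ Hash :: enc s.
Proof. by rewrite /enc /= -catA. Qed.

Lemma bits_Hash_inj w w' u v : all is_bit w -> all is_bit w' ->
  w ++ Hash :: u = w' ++ Hash :: v -> w = w' /\ u = v.
Proof.
elim: w w' => [|s w IH] [|s' w'] /=.
- by move=> _ _ [].
- by move=> _ /andP[sb _] [E]; rewrite -E in sb.
- by move=> /andP[sb _] _ [E]; rewrite E in sb.
by move=> /andP[_ wb] /andP[_ wb'] [-> /(IH _ wb wb')[-> ->]].
Qed.

Lemma bin_neq_nil x : exists s w, bin x = s :: w /\ is_bit s.
Proof.
case: (posnP x) => [->|/bin_pos[w ->]]; first by exists Zero, [::].
by exists One, w.
Qed.

(** Codes contain no blank and every block of bits ends at a [Hash], so the tape up to its first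
    blank parses in one way only. This makes the output of a teacher unique. *)
Lemma enc_inj s s' u u' : enc s ++ Bl :: u = enc s' ++ Bl :: u' -> s = s'.
Proof.
elim: s s' => [|x s IH] [|y s'] //; rewrite ?enc_cons.
- by case: (bin_neq_nil y) => a [w [-> ab]] /= [E]; rewrite -E in ab.
- by case: (bin_neq_nil x) => a [w [-> ab]] /= [E]; rewrite E in ab.
rewrite -!catA !cat_cons => /(bits_Hash_inj (bin_bits x) (bin_bits y)).
by case=> /bin_inj -> /IH ->.
Qed.

Lemma size_enc s : (size s).*2 <= size (enc s).
Proof.
elim: s => // x s IH; rewrite enc_cons size_cat /=.
by case: (bin_neq_nil x) => a [w [-> _]] /=; lia.
Qed.

Definition nonblank (s : sym) : bool := s != Bl.

Lemma bits_nonblank w : all is_bit w -> all nonblank w.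
Proof. by apply: sub_all => -[]. Qed.

Lemma enc_nonblank s : all nonblank (enc s).
Proof.
elim: s => // x s IH; rewrite enc_cons all_cat /= IH andbT.
exact/bits_nonblank/bin_bits.
Qed.

(** * Runs of machines *)

Section Runs.
Variables (M : TM) (o : nat -> bool).

Lemma exec_mono k fuel q l h r t tr v :
  exec M o fuel q l h r t tr = Some v -> exec M o (fuel + k) q l h r t tr = Some v.
Proof.
elim: fuel q l h r t tr => [|fuel IH] q l h r t tr /=.
  by case E: (lookup M q h) => [//|]; case: k => [|k] /=; rewrite E.
case: (lookup M q h) => // -[s d q'|qy qn]; last exact: IH.
by case: (move d l s r) => -[l' h'] r'; apply: IH.
Qed.

Lemma exec_fun f f' q l h r t tr v v' :
  exec M o f q l h r t tr = Some v -> exec M o f' q l h r t tr = Some v' -> v = v'.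
Proof.
by move=> /(exec_mono f') E /(exec_mono f); rewrite addnC E => -[].
Qed.

(** Each step uses one unit of fuel and advances the clock by one, so the elapsed time is itself
    enough fuel. *)
Lemma exec_time fuel q l h r t tr tape t' tr' :
  exec M o fuel q l h r t tr = Some (tape, t', tr') ->
  t <= t' /\ exec M o (t' - t) q l h r t tr = Some (tape, t', tr').
Proof.
elim: fuel q l h r t tr => [|fuel IH] q l h r t tr /=.
  by case E: (lookup M q h) => [//|] [<- <- <-]; rewrite leqnn subnn /= E.
case E: (lookup M q h) => [[s d q'|qy qn]|]; last first.
- by case=> <- <- <-; rewrite leqnn subnn /= E.
- move=> /IH[lt E']; split; first by lia.
  have -> : t' - t = (t' - t.+1).+1 by lia.
  by rewrite /= E.
case m: (move d l s r) => [[l' h'] r'] /IH[lt E']; split; first by lia.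
have -> : t' - t = (t' - t.+1).+1 by lia.
by rewrite /= E m.
Qed.

Lemma exec_some_indep fuel q l h r t tr t' tr' :
  isSome (exec M o fuel q l h r t tr) = isSome (exec M o fuel q l h r t' tr').
Proof.
elim: fuel q l h r t tr t' tr' => [|fuel IH] q l h r t tr t' tr' /=.
  by case: (lookup M q h).
case: (lookup M q h) => // -[s d q'|qy qn]; last exact: IH.
by case: (move d l s r) => -[l' h'] r'; apply: IH.
Qed.

(* Configurations whose scanned cell is the first one of [R], resp. of [L];
   both lists are implicitly padded with blanks. *)
Definition cfg := (nat * seq sym * sym * seq sym)%type.
Definition cr q (L R : seq sym) : cfg := (q, L, head Bl R, behead R).
Definition cl q (L R : seq sym) : cfg := (q, behead L, head Bl L, R).

Definition execc fuel (c : cfg) t tr :=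
  let: (q, l, h, r) := c in exec M o fuel q l h r t tr.

(** Quantifying over the remaining fuel, the clock and the transcript makes exact step counts and
    query lists add up under composition. *)
Definition reach n (qs : seq (nat * bool)) (c c' : cfg) : Prop :=
  forall fuel t tr, execc (n + fuel) c t tr = execc fuel c' (t + n) (tr ++ qs).

Lemma reach0 c : reach 0 [::] c c.
Proof. by move=> fuel t tr; rewrite addn0 cats0. Qed.

Lemma reach_trans n n' qs qs' c c' c'' :
  reach n qs c c' -> reach n' qs' c' c'' -> reach (n + n') (qs ++ qs') c c''.
Proof. by move=> H H' fuel t tr; rewrite -addnA H H' addnA catA. Qed.

Lemma reach_crR q L R s q' : lookup M q (head Bl R) = Some (Wr s Rgt q') ->
  reach 1 [::] (cr q L R) (cr q' (s :: L) (behead R)).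
Proof. by move=> E fuel t tr; rewrite /= E cats0 addn1; case: R E => [|? []]. Qed.

Lemma reach_crL q L R s q' : lookup M q (head Bl R) = Some (Wr s Lft q') ->
  reach 1 [::] (cr q L R) (cl q' L (s :: behead R)).
Proof. by move=> E fuel t tr; rewrite /= E cats0 addn1; case: L. Qed.

Lemma reach_crS q L R s q' : lookup M q (head Bl R) = Some (Wr s Stay q') ->
  reach 1 [::] (cr q L R) (cr q' L (s :: behead R)).
Proof. by move=> E fuel t tr; rewrite /= E cats0 addn1. Qed.

Lemma reach_clL q L R s q' : lookup M q (head Bl L) = Some (Wr s Lft q') ->
  reach 1 [::] (cl q L R) (cl q' (behead L) (s :: R)).
Proof. by move=> E fuel t tr; rewrite /= E cats0 addn1; case: L E => [|? []]. Qed.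

Lemma reach_clR q L R s q' : lookup M q (head Bl L) = Some (Wr s Rgt q') ->
  reach 1 [::] (cl q L R) (cr q' (s :: behead L) R).
Proof. by move=> E fuel t tr; rewrite /= E cats0 addn1; case: R. Qed.

Lemma reach_clS q L R s q' : lookup M q (head Bl L) = Some (Wr s Stay q') ->
  reach 1 [::] (cl q L R) (cl q' (s :: behead L) R).
Proof. by move=> E fuel t tr; rewrite /= E cats0 addn1. Qed.

Lemma reach_ask q L R qy qn : lookup M q (head Bl R) = Some (Ask qy qn) ->
  let x := readnum 0 (head Bl R :: behead R) in
  reach 1 [:: (x, o x)] (cr q L R) (cr (if o x then qy else qn) L R).
Proof. by move=> E x fuel t tr; rewrite /= E addn1 cats1. Qed.

Lemma sweepR q g w L R : {in w, forall s, lookup M q s = Some (Wr (g s) Rgt q)} ->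
  reach (size w) [::] (cr q L (w ++ R)) (cr q (rev (map g w) ++ L) R).
Proof.
elim: w L => [|s w IH] L H; first exact: reach0.
have E : lookup M q (head Bl ((s :: w) ++ R)) = Some (Wr (g s) Rgt q).
  by apply: H; rewrite mem_head.
rewrite /= rev_cons cat_rcons.
apply: (reach_trans (reach_crR _ E)); apply: IH => u u_w.
by apply: H; rewrite inE u_w orbT.
Qed.

Lemma sweepL q g w L R : {in w, forall s, lookup M q s = Some (Wr (g s) Lft q)} ->
  reach (size w) [::] (cl q (w ++ L) R) (cl q L (rev (map g w) ++ R)).
Proof.
elim: w R => [|s w IH] R H; first exact: reach0.
have E : lookup M q (head Bl ((s :: w) ++ L)) = Some (Wr (g s) Lft q).
  by apply: H; rewrite mem_head.
rewrite /= rev_cons cat_rcons.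
apply: (reach_trans (reach_clL _ E)); apply: IH => u u_w.
by apply: H; rewrite inE u_w orbT.
Qed.

Lemma skipR q w L R : {in w, forall s, lookup M q s = Some (Wr s Rgt q)} ->
  reach (size w) [::] (cr q L (w ++ R)) (cr q (rev w ++ L) R).
Proof. by move=> H; have := @sweepR q id w L R H; rewrite map_id. Qed.

Lemma skipL q w L R : {in w, forall s, lookup M q s = Some (Wr s Lft q)} ->
  reach (size w) [::] (cl q (w ++ L) R) (cl q L (rev w ++ R)).
Proof. by move=> H; have := @sweepL q id w L R H; rewrite map_id. Qed.

(** Forgets the number of steps: for enumerators and teachers only halting and the output count, not
    the time. *)
Definition leads c c' := exists n, reach n [::] c c'.

Lemma leads_refl c : leads c c.
Proof. by exists 0; apply: reach0. Qed.

Lemma leads_step n c c' c'' : reach n [::] c c' -> leads c' c'' -> leads c c''.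
Proof. by move=> H [n' H']; exists (n + n'); apply: (reach_trans H H'). Qed.

Lemma leads_trans c c' c'' : leads c c' -> leads c' c'' -> leads c c''.
Proof. by case=> n; apply: leads_step. Qed.

Definition halting c := exists fuel, isSome (execc fuel c 0 [::]).

Lemma halting_reach n qs c c' : reach n qs c c' -> halting c <-> halting c'.
Proof.
move: c c' => [[[q l] h] r] [[[q' l'] h'] r'] H; split=> -[fuel].
- case E: (execc fuel _ _ _) => [v|//] _; exists fuel.
  move: E => /(exec_mono n); rewrite addnC.
  have /= -> := H fuel 0 [::] => E.
  by rewrite /= (exec_some_indep _ _ _ _ _ _ _ n qs) E.
- move=> /= E; exists (n + fuel); have /= -> := H fuel 0 [::].
  by rewrite (exec_some_indep _ _ _ _ _ _ _ 0 [::]).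
Qed.

Lemma halting_leads c c' : leads c c' -> halting c <-> halting c'.
Proof. by case=> n /halting_reach. Qed.

Lemma leads_halting c c' : leads c c' -> halting c' -> halting c.
Proof. by move=> /halting_leads ->. Qed.

Lemma halting_cr q L R : lookup M q (head Bl R) = None -> halting (cr q L R).
Proof. by move=> E; exists 0; rewrite /= E. Qed.

Lemma halting_cl q L R : lookup M q (head Bl L) = None -> halting (cl q L R).
Proof. by move=> E; exists 0; rewrite /= E. Qed.

(** Membership is coded by halting, so the tables reject by such stationary loops. *)
Lemma looping_cr q L R :
  lookup M q (head Bl R) = Some (Wr (head Bl R) Stay q) -> ~ halting (cr q L R).
Proof.
move=> E [fuel]; rewrite /cr /=.
suff H t tr : exec M o fuel q L (head Bl R) (behead R) t tr = None by rewrite H.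
by elim: fuel t tr => [|fuel IH] t tr /=; rewrite E //= IH.
Qed.

Lemma res_fun s out t tr out' t' tr' :
  res M o s out t tr -> res M o s out' t' tr' -> [/\ out = out', t = t' & tr = tr'].
Proof.
move=> [tape [[f E] <-]] [tape' [[f' E'] <-]].
by case: (exec_fun E E') => -> -> ->.
Qed.

Lemma res_cr s n qs q L R : reach n qs (cr 0 [::] (enc s)) (cr q L R) ->
  lookup M q (head Bl R) = None -> res M o s (readnum 0 (head Bl R :: behead R)) n qs.
Proof.
move=> H E; exists (head Bl R :: behead R); split=> //; exists (n + 0).
by have /= -> := H 0 0 [::]; rewrite E.
Qed.

End Runs.

Arguments sweepR {M o q} g {w L R}.
Arguments sweepL {M o q} g {w L R}.
Arguments skipR {M o q w L R}.
Arguments skipL {M o q w L R}.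

Lemma haltsE M s : halts M s <-> halting M (fun=> false) (cr 0 [::] (enc s)).
Proof.
split=> [[out [t [tr [tape [[fuel E] _]]]]]|[fuel /=]]; first by exists fuel; rewrite /= E.
case E: (exec _ _ _ _ _ _ _ _ _) => [[[tape t] tr]|//] _.
by exists (readnum 0 tape), t, tr, tape; split=> //; exists fuel.
Qed.

Lemma res_seq_leads M s tau q L R rest :
  leads M (fun=> false) (cr 0 [::] (enc s)) (cr q L R) ->
  lookup M q (head Bl R) = None ->
  (head Bl R :: behead R) ++ [:: Bl] = enc tau ++ Bl :: rest -> res_seq M s tau.
Proof.
move=> [n H] E Et; exists (head Bl R :: behead R), n, [::], rest; split=> //.
exists (n + 0); by have /= -> := H 0 0 [::]; rewrite E.
Qed.

Lemma res_seq_fun M s tau tau' : res_seq M s tau -> res_seq M s tau' -> tau = tau'.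
Proof.
move=> [tape [t [tr [rest [[f E] Et]]]]] [tape' [t' [tr' [rest' [[f' E'] Et']]]]].
case: (exec_fun E E') => Ett _ _; apply: (@enc_inj _ _ rest rest').
by rewrite -Et -Et' Ett.
Qed.

Ltac step_with lem := eapply leads_step; [apply: lem; reflexivity|]; rewrite /=.
Ltac step_crR := step_with reach_crR.
Ltac step_crL := step_with reach_crL.
Ltac step_crS := step_with reach_crS.
Ltac step_clR := step_with reach_clR.
Ltac step_clL := step_with reach_clL.
Ltac step_clS := step_with reach_clS.

Lemma nseq_cons n (s : sym) u : nseq n s ++ s :: u = s :: nseq n s ++ u.
Proof. by elim: n => //= n ->. Qed.

Lemma rev_nseq n (s : sym) : rev (nseq n s) = nseq n s.
Proof. by elim: n => // n IH; rewrite /= rev_cons IH -cats1 nseq_cons cats0. Qed.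

Fixpoint ones_run (w : seq sym) : nat := if w is One :: w' then (ones_run w').+1 else 0.

Lemma ones_run_nseq m : ones_run (nseq m One) = m.
Proof. by elim: m => //= m ->. Qed.

Lemma all_onesVsplit w : all is_bit w ->
  w = nseq (size w) One \/ exists a u, w = nseq a One ++ Zero :: u.
Proof.
elim: w => [|s w IH] /=; first by left.
case/andP; case: s => // _ /IH[E|[a [u E]]]; rewrite E.
- by right; exists 0, (nseq (size w) One).
- by right; exists 0, (nseq a One ++ Zero :: u).
- by left; rewrite size_nseq.
- by right; exists a.+1, u.
Qed.

Lemma exec_queries M o fuel q l h r t tr tape t' tr' :
  exec M o fuel q l h r t tr = Some (tape, t', tr') -> size tr' + t <= size tr + t'.
Proof.
elim: fuel q l h r t tr => [|fuel IH] q l h r t tr /=.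
  by case: lookup => // -[_ <- <-].
case: lookup => [[s d q'|qy qn]|]; last by case=> _ <- <-.
  by case: (move d l s r) => -[l' h'] r' /IH; lia.
by move=> /IH; rewrite size_rcons; lia.
Qed.

Lemma size_tr_le_time M o s out t tr : res M o s out t tr -> size tr <= t.
Proof. by case=> tape [[fuel /exec_queries/= le] _]; lia. Qed.

(** Every query costs a step, so one bound [B] on the steps of each run controls both sums. *)
Lemma conv_withinI M o F A D i h (B : nat -> nat) b :
  same (F h) A ->
  (forall j, j <= i -> exists out t tr, res M o (D j) out t tr /\ t <= B j) ->
  (forall j, i <= j -> exists t tr, res M o (D j) h t tr) ->
  \sum_(j < i.+1) B j < b -> conv_within M o F A D b.
Proof.
move=> hA Hle Hge ltb.
have H j : exists p : nat * nat, j <= i ->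
    [/\ p.1 <= B j, p.2 <= B j & exists out tr, res M o (D j) out p.1 tr /\ p.2 = size tr].
  case: (leqP j i) => [/Hle[out [t [tr [r le]]]]|]; last by exists (0, 0).
  exists (t, size tr) => _; split=> //; last by exists out, tr.
  exact: leq_trans (size_tr_le_time r) le.
pose g j := proj1_sig (constructive_indefinite_description _ (H j)).
have gP j : j <= i -> _ := proj2_sig (constructive_indefinite_description _ (H j)).
exists i, h, (fun j => (g j).1), (fun j => (g j).2); split=> //; split.
  by move=> j /gP[].
split=> //.
by split; apply: leq_ltn_trans ltb; apply: leq_sum => j _; have [] := gP j (ltn_ord j).
Qed.

(** * Gold's obstruction to learning from positive data *)

Lemma min_index_exists F k : exists j, min_index F j /\ same (F j) (F k).
Proof.
elim/ltn_ind: k => k IH.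
case: (classic (exists2 j, j < k & same (F j) (F k))) => [[j /IH[j' [mj' Fj']] Fj]|H].
  by exists j'; split=> // x; rewrite Fj' Fj.
by exists k; split=> // j jk Fj; apply: H; exists j.
Qed.

(** The limit of a chain of prefixes: its entry [i] is already fixed in [s i.+1], which is longer
    than [i]. *)
Lemma mkseq_nth_prefix (s : nat -> seq nat) n :
  (forall i, prefix (s i) (s i.+1)) -> (forall i, i <= size (s i)) ->
  iseg (fun i => nth 0 (s i.+1) i) (size (s n)) = s n.
Proof.
move=> s_pre s_size.
have mono i j : i <= j -> prefix (s i) (s j).
  by move=> /subnK <-; elim: (j - i) => [|k IH]; [exact: prefix_refl|exact: prefix_trans IH _].
have nthE i j k : k < size (s i) -> i <= j -> nth 0 (s j) k = nth 0 (s i) k.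
  by move=> lt /mono/prefixP[u ->]; rewrite nth_cat lt.
apply: (@eq_from_nth _ 0); rewrite size_mkseq // => k lt; rewrite nth_mkseq //.
case: (leqP n k.+1) => [/nthE -> //|/ltnW le].
by rewrite (nthE k.+1 n).
Qed.

Lemma enum_prefix (s : seq nat) e A : {in s, forall x, A x} -> A e ->
  exists f, is_enum f A /\ iseg f (size s) = s.
Proof.
move=> sA Ae.
(* After [s] the sequence runs through all numbers, with [e] in place of those outside [A]. *)
pose f j := if j < size s then nth 0 s j
            else if excluded_middle_informative (A (j - size s)) then j - size s else e.
exists f; split; last first.
  apply: (@eq_from_nth _ 0); rewrite size_mkseq // => j lt.
  by rewrite nth_mkseq // /f lt.
split=> [j|x Ax].
  rewrite /f; case: ltnP => [lt|_]; first exact/sA/mem_nth.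
  by case: excluded_middle_informative.
exists (size s + x); rewrite /f ltnNge leq_addr /= addKn.
by case: excluded_middle_informative.
Qed.

(* The enumeration is forced through prefixes on which the learner names a set
   other than the whole of [nat]. *)
Lemma gold (F : nat -> nat -> Prop) (g : seq nat -> nat -> Prop) k0 :
  (forall s h h', g s h -> g s h' -> h = h') ->
  (forall x, F k0 x) ->
  (forall s : seq nat, exists k, {in s, forall x, F k x} /\ exists x, ~ F k x) ->
  (forall k f, is_enum f (F k) ->
     exists i h, same (F h) (F k) /\ forall j, i <= j -> g (iseg f j) h) -> False.
Proof.
move=> g_fun Fk0 Fs learn.
(* Follow an enumeration of some [F k] that contains [s] and [e] but misses an [x]; once the learner
   has converged on it, its hypothesis misses [x] too. *)
have next (s : seq nat) e : exists s', [/\ prefix s s', e \in s' &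
    exists h x, g s' h /\ ~ F h x].
  case: (Fs (rcons s e)) => k [sF [x Fx]].
  have Fe : F k e by apply: sF; rewrite mem_rcons mem_head.
  case: (enum_prefix sF Fe) => f [f_enum fs].
  case: (learn k f f_enum) => i [h [Fh gh]].
  have pre : prefix (rcons s e) (iseg f (maxn i (size (rcons s e)))).
    rewrite -{1}fs /iseg /mkseq -(subnKC (leq_maxr i (size (rcons s e)))) iotaD map_cat.
    exact: prefix_prefix.
  exists (iseg f (maxn i (size (rcons s e)))); split.
  - by apply: prefix_trans pre; rewrite -cats1 prefix_prefix.
  - by case/prefixP: pre => u ->; rewrite mem_cat mem_rcons mem_head.
  - by exists h, x; split; [apply: gh; apply: leq_maxl|rewrite Fh].
pose nx s e := proj1_sig (constructive_indefinite_description _ (next s e)).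
have nxP s e : _ := proj2_sig (constructive_indefinite_description _ (next s e)).
(* The appended 0 makes the prefixes grow strictly, and forcing the stage number into each stage
   puts every number into the limit. *)
pose fix st n := if n is n'.+1 then nx (st n' ++ [:: 0]) n' else [::].
have st_pre i : prefix (st i ++ [:: 0]) (st i.+1) by case: (nxP (st i ++ [:: 0]) i).
have st_pre' i : prefix (st i) (st i.+1).
  exact: prefix_trans (prefix_prefix _ _) (st_pre i).
have st_size i : i <= size (st i).
  elim: i => // i IH; have := size_prefix (st_pre i); rewrite size_cat /=; lia.
pose f i := nth 0 (st i.+1) i.
have fst n : iseg f (size (st n)) = st n by apply: mkseq_nth_prefix.
case: (learn k0 f) => [|i [h [Fh gh]]].
  split=> // x _; case: (nxP (st x ++ [:: 0]) x) => _ xin _.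
  have: x \in iseg f (size (st x.+1)) by rewrite fst.
  by case/mapP=> j _ ->; exists j.
(* Beyond the point of convergence on the limit there is still a prefix on which the learner names a
   proper subset of [nat]. *)
case: (nxP (st i ++ [:: 0]) i) => _ _ [h' [x [gh' Fx]]].
have E : h = h'.
  apply: (g_fun (st i.+1)) gh'; rewrite -fst; apply: gh.
  exact: leq_trans (st_size _).
by apply: Fx; rewrite -E Fh.
Qed.

(** * A family learnable with queries but not with a teacher *)

(* [E_run] accepts [n; x] unless the binary expansion of [n] is [1^m] and that of
   [x] starts with [1^m]: it deletes a leading 1 of [n] and of [x] in turn. *)
Definition E_run : TM :=
  [:: (0, One, Wr Bl Rgt 1); (0, Hash, Wr Hash Stay 0);
      (1, One, Wr One Rgt 1); (1, Hash, Wr Hash Rgt 2);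
      (2, Hash, Wr Hash Rgt 2); (2, One, Wr Hash Lft 3);
      (3, Hash, Wr Hash Lft 3); (3, One, Wr One Lft 3); (3, Bl, Wr Bl Rgt 0)].

Definition F_run n x := halts E_run [:: n; x].

(** Each round deletes a one on the left and turns a one of [w] into a [Hash], so the separator
    grows; hence the arbitrary [b]. The machine loops if the left run is exhausted first and halts
    if the run in [w] is. *)
Lemma E_run_compare o a L b w : all is_bit w ->
  halting E_run o (cr 0 L (nseq a One ++ nseq b.+1 Hash ++ w ++ [:: Hash])) <-> ones_run w < a.
Proof.
elim: a L b w => [|a IH] L b w wb.
  by split=> // H; case: (@looping_cr E_run o 0 L (nseq b.+1 Hash ++ w ++ [:: Hash])).
set L1 := nseq b Hash ++ Hash :: nseq a One.
have H1 : leads E_run o (cr 0 L (nseq a.+1 One ++ nseq b.+1 Hash ++ w ++ [:: Hash]))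
    (cr 2 (L1 ++ Bl :: L) (w ++ [:: Hash])).
  step_crR.
  eapply leads_step; first by apply: skipR => s /nseqP[->].
  step_crR.
  eapply leads_step; first by apply: skipR => s /nseqP[->].
  by rewrite !rev_nseq /L1 -catA; exact: leads_refl.
rewrite (halting_leads H1).
case: w wb {H1} => [|[] w] //= wb.
- by split=> // _; eapply leads_halting; [step_crR; apply: leads_refl|apply: halting_cr].
- by split=> // _; apply: halting_cr.
- have H2 : leads E_run o (cr 2 (L1 ++ Bl :: L) (One :: w ++ [:: Hash]))
      (cr 0 (Bl :: L) (nseq a One ++ nseq b.+2 Hash ++ w ++ [:: Hash])).
    step_crL.
    eapply leads_step.
      by apply: skipL => s; rewrite mem_cat inE => /or3P[/nseqP[->]|/eqP->|/nseqP[->]].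
    step_clR.
    rewrite rev_cat rev_cons !rev_nseq cat_rcons -!catA /= nseq_cons; exact: leads_refl.
  by rewrite (halting_leads H2) IH.
Qed.

Lemma F_run_ones n m x : bin n = nseq m One -> F_run n x <-> ones_run (bin x) < m.
Proof.
move=> E; rewrite /F_run haltsE !enc_cons E.
exact: (@E_run_compare _ m [::] 0 (bin x) (bin_bits x)).
Qed.

(** The scan of the index stops at its [Zero], for which neither state 0 nor state 1 has an entry,
    before [x] is looked at. *)
Lemma F_run_full n a u x : bin n = nseq a One ++ Zero :: u -> F_run n x.
Proof.
move=> E; rewrite /F_run haltsE !enc_cons E; case: a {E} => [|a]; first exact: halting_cr.
eapply leads_halting.
  step_crR; rewrite -catA.
  eapply leads_step; first by apply: skipR => s /nseqP[->].
  exact: leads_refl.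
exact: halting_cr.
Qed.

Lemma F_run_cases n : (forall x, F_run n x) \/ exists2 m, 0 < m & bin n = nseq m One.
Proof.
case: (all_onesVsplit (bin_bits n)) => [E|[a [u E]]]; [right|by left=> x; apply: F_run_full E].
by exists (size (bin n)) => //; case: (bin_neq_nil n) => s [w [->]].
Qed.

(* [M_run] overwrites the input by [1^l #] for growing [l] and asks for [1^l]; it
   stops at the first negative answer, leaving [1^l] as its hypothesis, or at the
   end of the input, with hypothesis 0. *)
Definition M_run : TM :=
  [:: (0, Zero, Wr One Rgt 1); (0, One, Wr One Rgt 1); (0, Hash, Wr One Rgt 1);
      (1, Zero, Wr Hash Lft 2); (1, One, Wr Hash Lft 2); (1, Hash, Wr Hash Lft 2);
      (2, One, Wr One Lft 2); (2, Bl, Wr Bl Rgt 3);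
      (3, One, Ask 4 5);
      (4, One, Wr One Rgt 4); (4, Hash, Wr One Rgt 1)].

(** The number [2 ^ m - 1], which serves both as a query and as an index. *)
Definition ones m := readnum 0 (nseq m One).

Lemma ones_ge m : m <= ones m.
Proof. by rewrite -ltnS readnum_ones ltn_expl. Qed.

(** The scanned cell becomes the [Hash] that ends the numeral [1^l] to its left; the head returns to
    the start of the numeral and asks. *)
Lemma M_run_ask o l L s R : 0 < l -> head Bl L = Bl -> nonblank s ->
  reach M_run o (l + 3) [:: (ones l, o (ones l))] (cr 1 (nseq l One ++ L) (s :: R))
    (cr (if o (ones l) then 4 else 5) (Bl :: behead L) (nseq l One ++ Hash :: R)).
Proof.
move=> l_gt0 L_Bl s_nb.
have H1 : reach M_run o 1 [::] (cr 1 (nseq l One ++ L) (s :: R)) (cl 2 (nseq l One ++ L)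
    (Hash :: R)).
  by apply: reach_crL; case: s s_nb.
have H2 : reach M_run o l [::] (cl 2 (nseq l One ++ L) (Hash :: R))
    (cl 2 L (nseq l One ++ Hash :: R)).
  rewrite -[X in reach M_run o X](size_nseq l One) -{3}[nseq l One]rev_nseq.
  by apply: skipL => u /nseqP[->].
have H3 : reach M_run o 1 [::] (cl 2 L (nseq l One ++ Hash :: R))
    (cr 3 (Bl :: behead L) (nseq l One ++ Hash :: R)).
  by apply: reach_clR; rewrite L_Bl.
have E_ask : lookup M_run 3 (head Bl (nseq l One ++ Hash :: R)) = Some (Ask 4 5).
  by case: l l_gt0 {H1 H2 H3}.
have H4 := reach_ask (M := M_run) o (Bl :: behead L) E_ask.
have E : readnum 0 (head Bl (nseq l One ++ Hash :: R) :: behead (nseq l One ++ Hash :: R)) = ones l.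
  have -> : head Bl (nseq l One ++ Hash :: R) :: behead (nseq l One ++ Hash :: R)
            = nseq l One ++ Hash :: R by case: l l_gt0 {H1 H2 H3 H4 E_ask}.
  by rewrite readnum_stop // all_nseq orbT.
cbv zeta in H4; rewrite E in H4.
have := reach_trans H1 (reach_trans H2 (reach_trans H3 H4)).
by rewrite (_ : 1 + _ = l + 3) //; lia.
Qed.

Lemma M_run_yes (o : nat -> bool) l L s R : 0 < l -> head Bl L = Bl -> nonblank s -> o (ones l) ->
  exists qs, reach M_run o (l.*2 + 4) qs (cr 1 (nseq l One ++ L) (s :: R))
               (cr 1 (nseq l.+1 One ++ Bl :: behead L) R).
Proof.
move=> l_gt0 L_Bl s_nb ol; eexists.
have := M_run_ask o R l_gt0 L_Bl s_nb; rewrite ol => H1.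
have H2 : reach M_run o l [::] (cr 4 (Bl :: behead L) (nseq l One ++ Hash :: R))
    (cr 4 (nseq l One ++ Bl :: behead L) (Hash :: R)).
  rewrite -[X in reach M_run o X](size_nseq l One) -{3}[nseq l One]rev_nseq.
  by apply: skipR => u /nseqP[->].
have H3 : reach M_run o 1 [::] (cr 4 (nseq l One ++ Bl :: behead L) (Hash :: R))
    (cr 1 (nseq l.+1 One ++ Bl :: behead L) R) by apply: reach_crR.
have := reach_trans H1 (reach_trans H2 H3).
by rewrite (_ : l + 3 + _ = l.*2 + 4); [apply|lia].
Qed.

(** Every positive answer uses up one input cell; when the cells run out first, the machine stops on
    a blank, which reads as hypothesis 0. *)
Lemma M_run_exhaust (o : nat -> bool) m l L R : 0 < l -> head Bl L = Bl -> all nonblank R ->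
  (forall j, 0 < j < m -> o (ones j)) -> l + size R <= m ->
  exists n qs L', n <= size R * (m.*2 + 4) /\
    reach M_run o n qs (cr 1 (nseq l One ++ L) R) (cr 1 L' [::]).
Proof.
move=> l_gt0 L_Bl R_nb om.
elim: R l L l_gt0 L_Bl R_nb => [|s R IH] l L l_gt0 L_Bl /=.
  by exists 0, [::], (nseq l One ++ L); split=> //; apply: reach0.
case/andP=> s_nb R_nb le.
have ol : o (ones l) by apply: om; lia.
have [qs H] := M_run_yes R l_gt0 L_Bl s_nb ol.
have [|||n [qs' [L' [le_n H']]]] := IH l.+1 (Bl :: behead L) _ _ R_nb; [by []|by []|lia|].
exists (l.*2 + 4 + n), (qs ++ qs'), L'; split; last exact: reach_trans H H'.
by rewrite mulSn; lia.
Qed.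

Lemma M_run_find (o : nat -> bool) m l L R : 0 < l <= m -> head Bl L = Bl -> all nonblank R ->
  (forall j, 0 < j < m -> o (ones j)) -> ~~ o (ones m) -> m < l + size R ->
  exists n qs L' R', n <= (m - l).+1 * (m.*2 + 4) /\
    reach M_run o n qs (cr 1 (nseq l One ++ L) R) (cr 5 L' (nseq m One ++ Hash :: R')).
Proof.
move=> le_lm L_Bl R_nb om nom.
elim: R l L le_lm L_Bl R_nb => [|s R IH] l L le_lm L_Bl /=; first by lia.
case/andP=> s_nb R_nb lt.
have l_gt0 : 0 < l by lia.
case: (ltnP l m) => [lt_lm|ge_lm]; last first.
  have eq_lm : l = m by lia.
  have := M_run_ask o R l_gt0 L_Bl s_nb; rewrite eq_lm (negbTE nom) => H.
  by do 4!eexists; split; last exact: H; rewrite subnn mul1n; lia.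
have ol : o (ones l) by apply: om; lia.
have [qs H] := M_run_yes R l_gt0 L_Bl s_nb ol.
have [|||n [qs' [L' [R' [le_n H']]]]] := IH l.+1 (Bl :: behead L) _ _ R_nb; [lia|by []|lia|].
exists (l.*2 + 4 + n), (qs ++ qs'), L', R'; split; last exact: reach_trans H H'.
by rewrite (_ : m - l = (m - l.+1).+1) ?mulSn; lia.
Qed.

Lemma enc_start x s : exists c w, [/\ enc (x :: s) = c :: w, is_bit c & all nonblank w].
Proof.
have := enc_nonblank (x :: s).
rewrite enc_cons; case: (bin_neq_nil x) => c [w [-> cb]] /= /andP[_ H].
by exists c, (w ++ Hash :: enc s).
Qed.

Lemma M_run_stops (o : nat -> bool) m s : (forall j, 0 < j < m -> o (ones j)) ->
    size (enc s) <= m ->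
  exists t tr, res M_run o s 0 t tr /\ t <= (m * (m.*2 + 4)).+1.
Proof.
move=> om; case: s => [|x s] le.
  by exists 0, [::]; split=> //; apply: (res_cr (reach0 _ _ _)).
have [c [w [E cb w_nb]]] := enc_start x s; rewrite E /= in le.
have [n [qs [L' [le_n H]]]] := @M_run_exhaust o m 1 [::] w isT erefl w_nb om le.
have H0 : reach M_run o 1 [::] (cr 0 [::] (enc (x :: s))) (cr 1 [:: One] w).
  by rewrite E; apply: reach_crR; case: c cb {E}.
exists (1 + n), qs; split; last by nia.
exact: (res_cr (reach_trans H0 H)).
Qed.

Lemma M_run_finds (o : nat -> bool) m s : (forall j, 0 < j -> o (ones j) = (j < m)) ->
    0 < m < size (enc s) ->
  exists t tr, res M_run o s (ones m) t tr /\ t <= (m * (m.*2 + 4)).+1.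
Proof.
move=> om; case: s => [|x s] /andP[m_gt0 lt]; first by [].
have [c [w [E cb w_nb]]] := enc_start x s; rewrite E /= in lt.
have om' j : 0 < j < m -> o (ones j) by case/andP=> j_gt0; rewrite om.
have nom : ~~ o (ones m) by rewrite om // ltnn.
have [n [qs [L' [R' [le_n H]]]]] := @M_run_find o m 1 [::] w m_gt0 erefl w_nb om' nom lt.
have H0 : reach M_run o 1 [::] (cr 0 [::] (enc (x :: s))) (cr 1 [:: One] w).
  by rewrite E; apply: reach_crR; case: c cb {E}.
exists (1 + n), qs; split; last by move: le_n; rewrite subn1 prednK.
have -> : ones m = readnum 0 (head Bl (nseq m One ++ Hash :: R') :: behead (nseq m One ++ Hash :: R')).
  by case: m m_gt0 {om om' lt nom le_n H} => // m _;
       rewrite -[RHS]/(readnum 0 (nseq m.+1 One ++ Hash :: R')) readnum_stop // all_nseq orbT.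
apply: (res_cr (reach_trans H0 H)).
by case: m m_gt0 {om om' lt nom le_n H}.
Qed.

Lemma F_run_PRT_O : PRT_O F_run.
Proof.
(* The polynomial [2k^3 + 8k^2 + 11k + 6] exceeds [m.+1] runs of at most [m * (m.*2 + 4) + 1] steps
   each, as [m <= k]. *)
exists M_run, [:: 6; 11; 8; 2] => k _ f _ o o_k.
have F0 x : F_run 0 x by apply: (@F_run_full 0 0 [::]).
case: (F_run_cases k) => [k_full|[m m_gt0 Ek]].
  have oT x : o x by apply/o_k.
  have H j : exists t tr, res M_run o (iseg f j) 0 t tr.
    have [t [tr [r _]]] := @M_run_stops o _ (iseg f j) (fun j _ => oT _) (leqnn _).
    by exists t, tr.
  (* Convergence happens already at the empty string, on which no step is made. *)
  apply: (@conv_withinI _ _ _ _ _ 0 0 (fun=> 0)); last by rewrite big1.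
  - by move=> x; split.
  - move=> j; rewrite leqn0 => /eqP ->.
    by exists 0, 0, [::]; split=> //; apply: (res_cr (reach0 _ _ _)).
  - by move=> j _; apply: H.
have om j : 0 < j -> o (ones j) = (j < m).
  move=> j_gt0; have E := F_run_ones (ones j) Ek; rewrite bin_ones // ones_run_nseq in E.
  by apply/idP/idP => [/o_k/E|/E/o_k].
have kE : k = ones m by rewrite -[k]bin_readnumK Ek.
have bound s : exists out t tr, res M_run o s out t tr /\ t <= (m * (m.*2 + 4)).+1.
  case: (leqP (size (enc s)) m) => le.
    have [|t [tr r]] := @M_run_stops o m s _ le; last by exists 0, t, tr.
    by move=> j /andP[j_gt0 lt]; rewrite om.
  have [|t [tr r]] := @M_run_finds o m s om; first by rewrite m_gt0.
  by exists (ones m), t, tr.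
(* From [m] items on, the code has at least [2 * m] cells, enough for the search to get to
   [ones m]. *)
apply: (@conv_withinI _ _ _ _ _ m (ones m) (fun=> (m * (m.*2 + 4)).+1)).
- by rewrite -kE.
- by move=> j _; apply: bound.
- move=> j le; have [|t [tr [r _]]] := @M_run_finds o m (iseg f j) om; last by exists t, tr.
  by have := size_enc (iseg f j); rewrite size_mkseq; lia.
- rewrite sum_nat_const card_ord /=.
  have le_mk : m <= k by rewrite kE ones_ge.
  have le1 : m * (m.*2 + 4) <= k * (k.*2 + 4) by apply: leq_mul; lia.
  have le2 : m.+1 * (m * (m.*2 + 4)).+1 <= k.+1 * (k * (k.*2 + 4)).+1 by apply: leq_mul; lia.
  by apply: leq_ltn_trans le2 _; lia.
Qed.

Lemma F_run_not_PRT_T : ~ PRT_T F_run.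
Proof.
move=> [M [T [p [_ [_ learn]]]]].
(* Teacher and learner together are a function of the data alone, as Gold's argument requires. *)
pose g s h := exists D, res_seq T s D /\ exists t tr, res M no_oracle D h t tr.
apply: (@gold F_run g 0).
- move=> s h h' [D [TD [t [tr r]]]] [D' [TD' [t' [tr' r']]]].
  by rewrite -(res_seq_fun TD TD') in r'; case: (res_fun r r').
- by move=> x; apply: (@F_run_full 0 0 [::]).
(* This [m] exceeds every leading run of ones in [s], so the set at index [ones m] contains [s]; it
   misses [ones m] itself. *)
- move=> s; pose m := (\max_(x <- s) ones_run (bin x)).+1.
  have Em : bin (ones m) = nseq m One by rewrite bin_ones.
  exists (ones m); split=> [x xs|]; last first.
    by exists (ones m); rewrite (F_run_ones _ Em) Em ones_run_nseq ltnn.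
  by rewrite (F_run_ones _ Em) ltnS;
      apply: (@leq_bigmax_seq _ s xpredT (fun y => ones_run (bin y)) x xs).
- move=> k f [fF Ff].
  have [j [j_min Fj]] := min_index_exists F_run k.
  have f_enum : is_enum f (F_run j) by split=> [n|x /Fj/Ff //]; apply/Fj.
  have [D [TD [i [h [ts [qs [Fh [_ [conv _]]]]]]]]] := learn j j_min f f_enum.
  exists i, h; split=> [x|j' le]; first by rewrite Fh Fj.
  by exists (D j'); split=> //; apply: conv.
Qed.

(** * Binary counters *)

(* Value of a counter written least significant digit first, [d1] being the
   digit one. *)
Definition cval (d1 : sym) (c : seq sym) : nat := foldr (fun s v => (s == d1) + v.*2) 0 c.

Lemma cval_ones d1 k : (cval d1 (nseq k d1)).+1 = 2 ^ k.
Proof. by elim: k => //= k IH; rewrite eqxx expnS -IH; lia. Qed.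

Section Counter.
Variables d1 d0 : sym.
Hypothesis d01 : d0 != d1.

Lemma cval0 c : all (mem [:: d1; d0]) c -> cval d1 c = 0 -> c = nseq (size c) d0.
Proof.
elim: c => //= s c IH /andP[]; rewrite !inE => /orP[]/eqP -> dc.
  by rewrite eqxx; lia.
by rewrite (negbTE d01) => v0; congr cons; apply: IH => //; lia.
Qed.

(** Subtraction with borrow: the low zeros become ones, and the first one becomes a zero. *)
Lemma cval_pred c v : all (mem [:: d1; d0]) c -> cval d1 c = v.+1 ->
  exists k c', [/\ c = nseq k d0 ++ d1 :: c', cval d1 (nseq k d1 ++ d0 :: c') = v &
                   all (mem [:: d1; d0]) (nseq k d1 ++ d0 :: c')].
Proof.
elim: c v => //= s c IH v /andP[]; rewrite !inE => /orP[]/eqP -> dc.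
  rewrite eqxx => E; exists 0, c; split=> //=; first by rewrite (negbTE d01); lia.
  by rewrite !inE eqxx orbT dc.
rewrite (negbTE d01) => E.
have [|k [c' [Ec Ev dc']]] := IH v./2 dc; first by lia.
exists k.+1, c'; split=> /=; first by rewrite Ec.
- by rewrite Ev eqxx; lia.
- by rewrite !inE eqxx dc'.
Qed.

End Counter.

(** * A family learnable with a teacher but not with queries *)

(* States 0-5 compare the leading runs of ones of [n] and [x], turning the run in
   [x] and the separator into [Hash]es; state 6 checks that the rest of [x], the
   pad, consists of zeros.  These [Hash]es then serve as a binary counter (a [Hash]
   counts as 1, [One] as 0), decremented in state 8; between two decrements,
   states 10-12 blank every second zero of the pad and loop if none was left.
   States 13-14 treat [n = 0]. *)
Definition E_pad : TM :=
  [:: (0, One, Wr Bl Rgt 1); (0, Hash, Wr Hash Rgt 5); (0, Zero, Wr Zero Rgt 13);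
      (1, One, Wr One Rgt 1); (1, Zero, Wr Zero Stay 1); (1, Hash, Wr Hash Rgt 2);
      (2, One, Wr Hash Lft 4); (2, Hash, Wr Hash Rgt 3);
      (3, Hash, Wr Hash Rgt 3); (3, One, Wr Hash Lft 4);
      (3, Zero, Wr Zero Stay 3); (3, Bl, Wr Bl Stay 3);
      (4, Hash, Wr Hash Lft 4); (4, One, Wr One Lft 4); (4, Bl, Wr Bl Rgt 0);
      (5, Hash, Wr Hash Rgt 5); (5, One, Wr One Stay 5); (5, Bl, Wr Bl Stay 5);
      (5, Zero, Wr Zero Rgt 6);
      (6, Zero, Wr Zero Rgt 6); (6, One, Wr One Stay 6); (6, Hash, Wr Hash Lft 7);
      (7, Zero, Wr Zero Lft 7); (7, Bl, Wr Bl Lft 7);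
      (7, One, Wr One Stay 8); (7, Hash, Wr Hash Stay 8);
      (8, One, Wr Hash Lft 8); (8, Hash, Wr One Rgt 9);
      (9, Hash, Wr Hash Rgt 9); (9, Zero, Wr Zero Stay 10); (9, Bl, Wr Bl Stay 10);
      (10, Bl, Wr Bl Rgt 10); (10, Zero, Wr Bl Rgt 11); (10, Hash, Wr Hash Stay 10);
      (11, Bl, Wr Bl Rgt 11); (11, Zero, Wr Zero Rgt 12); (11, Hash, Wr Hash Lft 7);
      (12, Bl, Wr Bl Rgt 12); (12, Zero, Wr Bl Rgt 11); (12, Hash, Wr Hash Lft 7);
      (13, Hash, Wr Hash Rgt 14); (14, One, Wr One Stay 14)].

Definition F_pad n x := halts E_pad [:: n; x].

Section E_pad.
Variable o : nat -> bool.

Fixpoint zeros (P : seq sym) : nat :=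
  match P with
  | [::] => 0
  | Zero :: P' => (zeros P').+1
  | _ :: P' => zeros P'
  end.

Lemma zeros_nseq k : zeros (nseq k Zero) = k.
Proof. by elim: k => //= k ->. Qed.

Definition is_pad (P : seq sym) := all (mem [:: Zero; Bl]) P.

(** [b] tells whether the next zero is kept (state 11) or blanked (state 12), that is, whether half
    of the count is rounded up or down. *)
Lemma E_pad_halve_from (b : bool) P L R : is_pad P ->
  exists (b' : bool) P', [/\ is_pad P', size P' = size P,
    zeros P' = (zeros P + b)./2 &
    leads E_pad o (cr (if b then 11 else 12) L (P ++ R))
               (cr (if b' then 11 else 12) (rev P' ++ L) R)].
Proof.
elim: P b L => [|s P IH] b L /=; first by exists b, [::]; split=> //; [case: b|exact: leads_refl].
case/andP; rewrite !inE => /orP[]/eqP -> padP.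
- have [b' [P' [pP' sP' cP' H]]] := IH (~~ b) ((if b then Zero else Bl) :: L) padP.
  exists b', ((if b then Zero else Bl) :: P'); split.
  + by case: b {H cP'}.
  + by rewrite /= sP'.
  + by case: b cP' {H} => /= ->; lia.
  + rewrite rev_cons cat_rcons; apply: leads_trans H.
    by case: b {cP'}; step_crR; exact: leads_refl.
- have [b' [P' [pP' sP' cP' H]]] := IH b (Bl :: L) padP.
  exists b', (Bl :: P'); split=> //; first by rewrite /= sP'.
  rewrite rev_cons cat_rcons; apply: leads_trans H.
  by case: b {cP'}; step_crR; exact: leads_refl.
Qed.

Lemma E_pad_halve P L : is_pad P -> 0 < zeros P ->
  exists P', [/\ is_pad P', size P' = size P, zeros P' = (zeros P)./2 &
    leads E_pad o (cr 10 L (P ++ [:: Hash])) (cl 7 L (P' ++ [:: Hash]))].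
Proof.
elim: P L => //= s P IH L /andP[]; rewrite !inE => /orP[]/eqP -> padP.
- move=> _; have [b' [P' [pP' sP' cP' H]]] := E_pad_halve_from true (Bl :: L) [:: Hash] padP.
  exists (Bl :: P'); split=> //; [by rewrite /= sP'|by rewrite /= cP'; lia|].
  step_crR; apply: leads_trans H _.
  eapply leads_trans.
    by case: b'; step_crL; exact: leads_refl.
  rewrite -cat_rcons -rev_cons.
  eapply leads_step.
    apply: skipL => s'; rewrite mem_rev inE => /orP[/eqP -> //|/(allP pP')].
    by rewrite !inE => /orP[]/eqP ->.
  by rewrite revK; exact: leads_refl.
- move=> c_gt0; have [P' [pP' sP' cP' H]] := IH (Bl :: L) padP c_gt0.
  exists (Bl :: P'); split=> //; first by rewrite /= sP'.
  step_crR; apply: leads_trans H _.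
  by step_clL; exact: leads_refl.
Qed.

Lemma E_pad_empty_pad P L : is_pad P -> zeros P = 0 ->
  ~ halting E_pad o (cr 10 L (P ++ [:: Hash])).
Proof.
elim: P L => [|s P IH] L /=; first by move=> _ _; apply: looping_cr.
case/andP; rewrite !inE => /orP[]/eqP -> //= padP c0.
have H : leads E_pad o (cr 10 L (Bl :: P ++ [:: Hash])) (cr 10 (Bl :: L) (P ++ [:: Hash])).
  by step_crR; exact: leads_refl.
by rewrite (halting_leads H); apply: IH.
Qed.

(** Each decrement of a positive counter is followed by a halving, which loops on a pad without
    zeros; all [v] halvings succeed exactly when the first [v.-1] leave a zero. At value 0 the
    borrow runs through the whole counter and the machine halts. *)
Lemma E_pad_count v c P L : all (mem [:: Hash; One]) c -> 0 < size c -> cval Hash c = v ->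
  is_pad P -> 0 < size P ->
  halting E_pad o (cl 7 (c ++ Bl :: L) (P ++ [:: Hash])) <->
  v = 0 \/ 2 ^ v.-1 <= zeros P.
Proof.
elim: v c P => [|v IH] c P dc c_gt0 Ec padP P_gt0.
  split=> [_|_]; first by left.
  have [k {c dc c_gt0 Ec}->] : exists k, c = nseq k.+1 One.
    by exists (size c).-1; rewrite prednK //; apply: cval0 dc Ec.
  eapply leads_halting.
    step_clS; rewrite -[One :: _]/(nseq k.+1 One ++ Bl :: L).
    eapply leads_step; first by apply: (sweepL (fun=> Hash)) => s /nseqP[->].
    exact: leads_refl.
  exact: halting_cl.
have [k [c' [Ecc Ev dc']]] := cval_pred (d1 := Hash) (d0 := One) isT dc Ec.
set c2 := nseq k Hash ++ One :: c' in Ev dc'.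
have c2_gt0 : 0 < size c2 by rewrite size_cat /=; lia.
have H : leads E_pad o (cl 7 (c ++ Bl :: L) (P ++ [:: Hash])) (cr 10 (c2 ++ Bl :: L)
    (P ++ [:: Hash])).
  apply: (@leads_trans _ _ _ (cl 8 (c ++ Bl :: L) (P ++ [:: Hash]))).
    case: c dc c_gt0 {Ec Ecc} => // s c /andP[]; rewrite !inE => /orP[]/eqP -> _ _;
    by step_clS; exact: leads_refl.
  rewrite Ecc -catA.
  eapply leads_step; first by apply: (sweepL (fun=> Hash)) => s /nseqP[->].
  rewrite map_nseq rev_nseq; step_clR.
  eapply leads_step; first by apply: skipR => s /nseqP[->].
  rewrite rev_nseq /c2 -catA.
  case: P padP P_gt0 => // s P /andP[]; rewrite !inE => /orP[]/eqP -> _ _;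
  by step_crS; exact: leads_refl.
rewrite (halting_leads H) /=.
case: (posnP (zeros P)) => [c0|c_gt0'].
  split; first by move/(E_pad_empty_pad padP c0).
  by case=> //; rewrite c0 leqNgt expn_gt0.
have [P' [padP' sP' cP' H']] := E_pad_halve (c2 ++ Bl :: L) padP c_gt0'.
rewrite (halting_leads H') (IH c2 P') // ?sP' // cP'.
have [->|v_gt0] := posnP v; first by split=> _; [right|left].
have Ev2 : 2 ^ v = (2 ^ v.-1).*2 by rewrite -mul2n -expnS prednK.
by rewrite Ev2; split=> -[|] le; [lia|right; lia|lia|right; lia].
Qed.

Lemma E_pad_mark (b2 : bool) a b L w :
  leads E_pad o (cr (if b2 then 2 else 3) (nseq b Hash ++ Hash :: nseq a One ++ Bl :: L)
                 (One :: w ++ [:: Hash]))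
    (cr 0 (Bl :: L) (nseq a One ++ nseq b.+2 Hash ++ w ++ [:: Hash])).
Proof.
apply: (@leads_trans _ _ _ (cl 4 (nseq b Hash ++ Hash :: nseq a One ++ Bl :: L)
    (Hash :: w ++ [:: Hash]))).
  by case: b2; step_crL; exact: leads_refl.
rewrite -cat_cons catA.
eapply leads_step.
  by apply: skipL => s; rewrite mem_cat inE => /or3P[/nseqP[->]|/eqP->|/nseqP[->]].
step_clR.
rewrite rev_cat rev_cons !rev_nseq cat_rcons -!catA /= nseq_cons; exact: leads_refl.
Qed.

Lemma zeros_split w : all is_bit w ->
  (exists k, w = nseq k Zero) \/ exists k u, w = nseq k Zero ++ One :: u.
Proof.
elim: w => [|s w IH] /=; first by left; exists 0.
case/andP; case: s => // _ => [/IH[[k ->]|[k [u ->]]]|wb].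
- by left; exists k.+1.
- by right; exists k.+1, u.
- by right; exists 0, w.
Qed.

(** Every matched one adds a [Hash] to the separator, so the final counter consists of [a + b.+2]
    digits one and has value [2 ^ (a + b.+2) - 1]. *)
Lemma E_pad_compare a b L w : all is_bit w ->
  halting E_pad o (cr 0 (Bl :: L) (nseq a One ++ nseq b.+2 Hash ++ w ++ [:: Hash])) <->
  exists k, w = nseq a One ++ nseq k.+1 Zero /\ 2 ^ (2 ^ (a + b.+2) - 2) <= k.+1.
Proof.
elim: a b L w => [|a IH] b L w wb; rewrite ?add0n ?cat0s.
  have H : leads E_pad o (cr 0 (Bl :: L) (nseq b.+2 Hash ++ w ++ [:: Hash]))
      (cr 5 (nseq b.+2 Hash ++ Bl :: L) (w ++ [:: Hash])).
    step_crR; rewrite -[Hash :: nseq b Hash ++ _]/(nseq b.+1 Hash ++ _).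
    eapply leads_step; first by apply: skipR => s /nseqP[->].
    rewrite rev_nseq nseq_cons; exact: leads_refl.
  rewrite (halting_leads H) {H}.
  case: w wb => [|[] w] //= wb.
  - split; last by case=> k [].
    have H : leads E_pad o (cr 5 (Hash :: Hash :: nseq b Hash ++ Bl :: L) [:: Hash])
       (cr 5 (nseq b.+3 Hash ++ Bl :: L) [::]) by step_crR; exact: leads_refl.
    by rewrite (halting_leads H) => h; case: (@looping_cr E_pad o 5 _ [::] erefl h).
  - case: (zeros_split wb) => [[k Ew]|[k [u Ew]]]; last first.
      split; last first.
        case=> k' [[E] _]; move: Ew; rewrite E => /(congr1 (fun s => One \in s)).
        by rewrite mem_cat mem_head orbT mem_nseq andbF.
      have H : leads E_pad o (cr 5 (Hash :: Hash :: nseq b Hash ++ Bl :: L)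
          (Zero :: w ++ [:: Hash]))
          (cr 6 (nseq k Zero ++ Zero :: nseq b.+2 Hash ++ Bl :: L) (One :: u ++ [:: Hash])).
        step_crR; rewrite Ew -catA.
        eapply leads_step; first by apply: skipR => s /nseqP[->].
        rewrite rev_nseq; exact: leads_refl.
      by rewrite (halting_leads H); move/looping_cr; case.
    have H : leads E_pad o (cr 5 (Hash :: Hash :: nseq b Hash ++ Bl :: L) (Zero :: w ++ [:: Hash]))
       (cl 7 (nseq b.+2 Hash ++ Bl :: L) (nseq k.+1 Zero ++ [:: Hash])).
      step_crR; rewrite Ew.
      eapply leads_step; first by apply: skipR => s /nseqP[->].
      step_crL; rewrite rev_nseq nseq_cons -[Zero :: nseq k Zero ++ _]/(nseq k.+1 Zero ++ _).
      eapply leads_step; first by apply: skipL => s /nseqP[->].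
      rewrite rev_nseq; exact: leads_refl.
    have dig : all (mem [:: Hash; One]) (nseq b.+2 Hash) by rewrite all_nseq.
    have pad : is_pad (nseq k.+1 Zero) by rewrite /is_pad all_nseq.
    rewrite (halting_leads H) (E_pad_count _ dig _ erefl pad) //.
    have Ev := cval_ones Hash b.+2.
    have p4 : 3 < 2 ^ b.+2 by rewrite !expnS; have := expn_gt0 2 b; lia.
    set v := cval _ _ in Ev *; rewrite zeros_nseq (_ : v.-1 = 2 ^ b.+2 - 2); last by lia.
    split=> [[|le]|[k' [[E] le]]]; [lia|by exists k; rewrite Ew|right].
    by have := congr1 size E; rewrite Ew !size_nseq => ->.
  - split; last by case=> k [].
    by move/looping_cr; case.
have H : leads E_pad o (cr 0 (Bl :: L) (nseq a.+1 One ++ nseq b.+2 Hash ++ w ++ [:: Hash]))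
    (cr 3 (nseq b.+1 Hash ++ Hash :: nseq a One ++ Bl :: Bl :: L) (w ++ [:: Hash])).
  step_crR.
  eapply leads_step; first by apply: skipR => s /nseqP[->].
  step_crR; step_crR.
  eapply leads_step; first by apply: skipR => s /nseqP[->].
  rewrite !rev_nseq (nseq_cons b Hash (Hash :: _)); exact: leads_refl.
rewrite (halting_leads H) {H}.
case: w wb => [|[] w] //= wb.
- split; last by case=> k [].
  set L2 := Hash :: _.
  have H : leads E_pad o (cr 3 L2 [:: Hash]) (cr 3 (Hash :: L2) [::]) by step_crR;
      exact: leads_refl.
  by rewrite (halting_leads H) => h; case: (@looping_cr E_pad o 3 _ [::] erefl h).
- split; last by case=> k [].
  by move/looping_cr; case.
- rewrite (halting_leads (@E_pad_mark false a b.+1 (Bl :: L) w)) IH // addnS.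
  by split=> -[k [E le]]; exists k; split=> //; [rewrite E|case: E].
Qed.

End E_pad.

(** * The members of [F_pad] *)

Lemma F_pad_zero x : F_pad 0 x <-> x = 0.
Proof.
rewrite /F_pad haltsE !enc_cons.
have H : leads E_pad (fun=> false) (cr 0 [::] (bin 0 ++ Hash :: bin x ++ Hash :: enc [::]))
    (cr 14 [:: Hash; Zero] (bin x ++ [:: Hash])) by step_crR; step_crR; exact: leads_refl.
rewrite (halting_leads H); have [->|/[dup] x_gt0 /bin_pos[w ->]] := posnP x.
  by split=> // _; apply: halting_cr.
by split=> [/looping_cr|x0]; [case|rewrite x0 in x_gt0].
Qed.

Lemma F_pad_empty n a u x : bin n = nseq a.+1 One ++ Zero :: u -> ~ F_pad n x.
Proof.
move=> E; rewrite /F_pad haltsE !enc_cons E.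
set R := bin x ++ _.
have H : leads E_pad (fun=> false) (cr 0 [::] ((nseq a.+1 One ++ Zero :: u) ++ Hash :: R))
    (cr 1 (nseq a One ++ [:: Bl]) (Zero :: u ++ Hash :: R)).
  step_crR; rewrite -catA.
  eapply leads_step; first by apply: skipR => s /nseqP[->].
  by rewrite rev_nseq; exact: leads_refl.
by rewrite (halting_leads H); apply: looping_cr.
Qed.

Lemma F_pad_ones n m x : bin n = nseq m.+1 One ->
  F_pad n x <-> x = 0 \/ exists k, bin x = nseq m.+1 One ++ nseq k.+1 Zero /\
      2 ^ (2 ^ m.+2 - 2) <= k.+1.
Proof.
move=> E; rewrite /F_pad haltsE !enc_cons E.
have H : leads E_pad (fun=> false) (cr 0 [::] (nseq m.+1 One ++ Hash :: bin x ++ Hash :: enc [::]))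
    (cr 2 (Hash :: nseq m One ++ [:: Bl]) (bin x ++ [:: Hash])).
  step_crR.
  eapply leads_step; first by apply: skipR => s /nseqP[->].
  by step_crR; rewrite rev_nseq; exact: leads_refl.
rewrite (halting_leads H); have [->|/[dup] x_gt0 /bin_pos[w Ew]] := posnP x.
  by split=> _; [left|apply: halting_cr].
have wb : all is_bit w by have := bin_bits x; rewrite Ew.
rewrite Ew (halting_leads (@E_pad_mark _ true m 0 [::] w)) E_pad_compare // addn2.
split=> [[k [-> le]]|[x0|[k [[->] le]]]]; [by right; exists k|by rewrite x0 in x_gt0|by exists k].
Qed.

(** * Learning [F_pad] with a teacher *)

Lemma oracle_freeI (M : TM) : all (fun e => if e.2 is Ask _ _ then false else true) M ->
  oracle_free M.
Proof.
elim: M => //= -[[q' s'] a] M IH /andP[na /IH{}IH] q s qy qn /=.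
by case: ifP => _; [case=> E; rewrite E in na|apply: IH].
Qed.

(* [T_pad] passes on the first nonzero number only, and nothing before it shows up. *)
Definition T_pad : TM :=
  [:: (0, Zero, Wr Bl Rgt 0); (0, Hash, Wr Bl Rgt 0); (0, One, Wr One Rgt 1);
      (1, Zero, Wr Zero Rgt 1); (1, One, Wr One Rgt 1); (1, Hash, Wr Hash Rgt 2);
      (2, Zero, Wr Bl Lft 3); (2, One, Wr Bl Lft 3); (2, Hash, Wr Bl Lft 3); (2, Bl, Wr Bl Lft 3);
      (3, Zero, Wr Zero Lft 3); (3, One, Wr One Lft 3); (3, Hash, Wr Hash Lft 3);
      (3, Bl, Wr Bl Rgt 4)].

Definition first_nonzero (s : seq nat) : seq nat := take 1 [seq x <- s | x != 0].

(** The blank to the left lets the return pass find the start of the number. A blank written after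
    its [Hash] cuts off the remaining data, which stay on the tape as [rest]. *)
Lemma T_pad_run o s L : head Bl L = Bl -> exists q L' R rest,
  [/\ leads T_pad o (cr 0 L (enc s)) (cr q L' R), lookup T_pad q (head Bl R) = None &
      (head Bl R :: behead R) ++ [:: Bl] = enc (first_nonzero s) ++ Bl :: rest].
Proof.
elim: s L => [|x s IH] L L_Bl.
  by exists 0, L, [::], [:: Bl]; split=> //; exact: leads_refl.
have [->|/[dup] x_gt0 /bin_pos[w Ew]] := posnP x.
  have [q [L' [R [rest [H Hq E]]]]] := IH (Bl :: Bl :: L) erefl.
  exists q, L', R, rest; split=> //; apply: leads_trans H.
  by rewrite enc_cons; step_crR; step_crR; exact: leads_refl.
have wb : all is_bit w by have := bin_bits x; rewrite Ew.
exists 4, (Bl :: behead L), (One :: w ++ Hash :: Bl :: behead (enc s)), (rcons (behead (enc s)) Bl).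
split=> //; last first.
  by rewrite /first_nonzero /= -lt0n x_gt0 /= take0 enc_cons Ew /= -!catA /= -cats1.
rewrite enc_cons Ew /=; step_crR.
eapply leads_step.
  by apply: skipR => a /(allP wb); case: a.
step_crR.
apply: (@leads_trans _ _ _ (cl 3 (Hash :: rev w ++ One :: L) (Bl :: behead (enc s)))).
  eapply leads_step; last exact: leads_refl.
  by apply: reach_crL; case: (head Bl (enc s)).
rewrite -cat_cons -cat_rcons.
eapply leads_step.
  apply: skipL => a; rewrite mem_rcons !inE => /or3P[/eqP->//|/eqP->//|].
  by rewrite mem_rev => /(allP wb); case: a.
rewrite rev_rcons rev_cons revK /= cat_rcons.
eapply leads_step; last exact: leads_refl.
by apply: reach_clR; rewrite L_Bl.
Qed.

Lemma T_pad_res s : res_seq T_pad s (first_nonzero s).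
Proof.
have [q [L [R [rest [H Hq E]]]]] := T_pad_run (fun=> false) s (L := [::]) erefl.
exact: res_seq_leads H Hq E.
Qed.

Lemma T_pad_teacher : teacher T_pad.
Proof.
split; first exact: oracle_freeI.
split; first by move=> s; exists (first_nonzero s); apply: T_pad_res.
split=> [s s' tau tau' /res_seq_fun E /res_seq_fun E'|s tau /res_seq_fun E x].
  rewrite (E _ (T_pad_res s)) (E' _ (T_pad_res s')) => /prefixP[u ->].
  rewrite /first_nonzero filter_cat; case: [seq _ <- s | _] => [|a v]; first exact: prefix0s.
  by rewrite /= !take0 eqxx.
by rewrite (E _ (T_pad_res s)) => /mem_take; rewrite mem_filter => /andP[].
Qed.

(* [M_pad] truncates [1^m 0 ...] to [1^m]. *)
Definition M_pad : TM :=
  [:: (0, One, Wr One Rgt 1);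
      (1, One, Wr One Rgt 1); (1, Zero, Wr Hash Lft 2);
      (2, One, Wr One Lft 2); (2, Bl, Wr Bl Rgt 3)].

Lemma M_pad_res o x m u : bin x = nseq m.+1 One ++ Zero :: u ->
  res M_pad o [:: x] (ones m.+1) (m.*2 + 4) [::].
Proof.
move=> E.
set R := u ++ [:: Hash].
have Ee : enc [:: x] = One :: nseq m One ++ Zero :: R by rewrite enc_cons E /= -catA.
have H1 : reach M_pad o 1 [::] (cr 0 [::] (enc [:: x])) (cr 1 [:: One] (nseq m One ++ Zero :: R)).
  by rewrite Ee; apply: reach_crR.
have H2 : reach M_pad o m [::] (cr 1 [:: One] (nseq m One ++ Zero :: R)) (cr 1 (nseq m.+1 One)
    (Zero :: R)).
  have := @skipR M_pad o 1 (nseq m One) [:: One] (Zero :: R).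
  by rewrite size_nseq rev_nseq nseq_cons cats0; apply=> s /nseqP[->].
have H3 : reach M_pad o 1 [::] (cr 1 (nseq m.+1 One) (Zero :: R)) (cl 2 (nseq m.+1 One)
    (Hash :: R)).
  exact: reach_crL.
have H4 : reach M_pad o m.+1 [::] (cl 2 (nseq m.+1 One) (Hash :: R)) (cl 2 [::]
    (nseq m.+1 One ++ Hash :: R)).
  have := @skipL M_pad o 2 (nseq m.+1 One) [::] (Hash :: R).
  by rewrite size_nseq rev_nseq cats0; apply=> s /nseqP[->].
have H5 : reach M_pad o 1 [::] (cl 2 [::] (nseq m.+1 One ++ Hash :: R)) (cr 3 [:: Bl]
    (nseq m.+1 One ++ Hash :: R)).
  exact: reach_clR.
have H := reach_trans H1 (reach_trans H2 (reach_trans H3 (reach_trans H4 H5))).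
rewrite (_ : m.*2 + 4 = 1 + (m + (1 + (m.+1 + 1)))); last by lia.
rewrite (_ : ones m.+1 = readnum 0 (nseq m.+1 One ++ Hash :: R)); last first.
  by rewrite readnum_stop // all_nseq orbT.
exact: (res_cr H).
Qed.

Lemma F_pad_cases n : [\/ n = 0, (forall x, ~ F_pad n x) |
    exists2 m, n = ones m.+1 & bin n = nseq m.+1 One].
Proof.
have [->|/bin_pos[w E]] := posnP n; first by constructor.
case: (all_onesVsplit (bin_bits n)) => [En|[a [u En]]].
  rewrite E /= in En; constructor 3; exists (size w); last by rewrite E.
  by rewrite -[n]bin_readnumK E En.
constructor 2=> x; case: a En => [|a] En; first by rewrite E in En.
exact: F_pad_empty En.
Qed.

Lemma bin_onesS m : bin (ones m.+1) = nseq m.+1 One.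
Proof. exact: bin_ones. Qed.

Lemma F_pad_nonzero m : exists x, F_pad (ones m.+1) x /\ 0 < x.
Proof.
pose K := 2 ^ (2 ^ m.+2 - 2).
exists (readnum 0 (nseq m.+1 One ++ nseq K.+1 Zero)); split; last exact: readnum_One_gt0.
apply/(F_pad_ones _ (bin_onesS m)); right; exists K; split=> //.
by apply: readnumK; rewrite all_cat !all_nseq !orbT.
Qed.

Lemma F_pad_zero_in m : F_pad (ones m.+1) 0.
Proof. by apply/(F_pad_ones _ (bin_onesS m)); left. Qed.

Lemma F_pad_big m x : F_pad (ones m.+1) x -> 0 < x ->
  exists k, bin x = nseq m.+1 One ++ nseq k.+1 Zero /\ 2 ^ (ones m.+1).*2 <= k.+1.
Proof.
move=> /(F_pad_ones _ (bin_onesS m))[->//|[k [E le]]] _.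
exists k; split=> //; rewrite (_ : (ones m.+1).*2 = 2 ^ m.+2 - 2) //.
by rewrite expnS -(readnum_ones m.+1) -/(ones m.+1); lia.
Qed.

(** The leading run of ones of any nonzero member gives back the index. *)
Lemma F_pad_min_index m : min_index F_pad (ones m.+1).
Proof.
move=> j lt_j Fj; have [x [Fx x_gt0]] := F_pad_nonzero m.
have [k [E _]] := F_pad_big Fx x_gt0.
case: (F_pad_cases j) => [j0|j_empty|[m' Ej _]].
- by move: Fx; rewrite -Fj j0 => /F_pad_zero x0; rewrite x0 in x_gt0.
- by apply: (j_empty x); apply/Fj.
have /Fj := Fx; rewrite Ej => /F_pad_big/(_ x_gt0)[k' [E' _]].
have run a b : ones_run (nseq a One ++ nseq b.+1 Zero) = a by elim: a => //= a ->.
have : m.+1 = m'.+1 by rewrite -(run m.+1 k) -(run m'.+1 k') -E -E'.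
by move=> Em; rewrite Ej Em ltnn in lt_j.
Qed.

Lemma first_nonzero_iseg f j0 j : (forall i, i < j0 -> f i = 0) -> f j0 != 0 ->
  first_nonzero (iseg f j) = if j <= j0 then [::] else [:: f j0].
Proof.
move=> f0 fj0.
have all0 i : i <= j0 -> [seq x <- iseg f i | x != 0] = [::].
  move=> le; apply/eqP; rewrite -(negbK (_ == _)) -has_filter.
  by apply/hasPn => x /mapP[i']; rewrite mem_iota => /andP[_ lt] ->; rewrite f0 //; lia.
rewrite /first_nonzero; case: leqP => [/all0 -> //|lt].
rewrite -[iseg f j](cat_take_drop j0) (drop_nth 0) ?size_mkseq // nth_mkseq //.
rewrite -map_take take_iota (minn_idPl (ltnW lt)) filter_cat all0 //.
by rewrite /= fj0 /= take0.
Qed.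

Lemma F_pad_PRT_T : PRT_T F_pad.
Proof.
exists M_pad, T_pad, [:: 3; 2]; split; first exact: oracle_freeI.
split; first exact: T_pad_teacher.
move=> k _ f [fF Ff]; exists (fun n => first_nonzero (iseg f n)).
split=> [n|]; first exact: T_pad_res.
have M_nil : res M_pad no_oracle [::] 0 0 [::] by apply: (res_cr (reach0 _ _ _)).
case: (F_pad_cases k) => [k0|k_empty|[m Ek _]]; last 2 first.
- by case: (k_empty _ (fF 0)).
- have [x [Fx x_gt0]] := F_pad_nonzero m.
  have ex : exists j, f j != 0.
    by move: Fx; rewrite -Ek => /Ff[j Ej]; exists j; rewrite Ej -lt0n.
  case: (ex_minnP ex) => j0 fj0 j0_min.
  have f0 i : i < j0 -> f i = 0.
    by move=> lt; apply/eqP; apply: contraTT lt => /j0_min; rewrite leqNgt.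
  have E j := first_nonzero_iseg j f0 fj0.
  have Ffj0 : F_pad (ones m.+1) (f j0) by rewrite -Ek.
  have fj0_gt0 : 0 < f j0 by rewrite lt0n.
  have [k' [Ef _]] := F_pad_big Ffj0 fj0_gt0.
  have r := M_pad_res no_oracle Ef.
  (* Stage [j0.+1] is the first with a nonempty teacher output. The earlier runs are on the empty
     string and cost nothing, however large [j0] is. *)
  apply: (@conv_withinI _ _ _ _ _ j0.+1 k (fun j => if j == j0.+1 then m.*2 + 4 else 0)) => //.
  + move=> j le; rewrite E; case: leqP => lt; first by exists 0, 0, [::].
    by exists (ones m.+1), (m.*2 + 4), [::]; split=> //; rewrite (_ : j = j0.+1) ?eqxx //; lia.
  + move=> j le; rewrite E leqNgt le /= Ek.
    by exists (m.*2 + 4), [::].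
  + rewrite big_ord_recr /= eqxx big1 => [|i _]; last by rewrite ltn_eqF.
    by have := ones_ge m.+1; rewrite -Ek; lia.
have E j : first_nonzero (iseg f j) = [::].
  rewrite /first_nonzero (_ : [seq _ <- _ | _] = [::]) //; apply/eqP;
      rewrite -(negbK (_ == _)) -has_filter.
  by apply/hasPn => x /mapP[i _ ->]; rewrite negbK; apply/eqP/F_pad_zero; rewrite -k0.
apply: (@conv_withinI _ _ _ _ _ 0 0 (fun=> 0)); last by rewrite big1.
- by rewrite k0.
- by move=> j _; rewrite E; exists 0, 0, [::].
- by move=> j _; rewrite E; exists 0, [::].
Qed.

(** * Queries do not suffice for [F_pad] *)

(** A query is a numeral on the tape, and the tape length plus the remaining fuel never grows, so
    the numeral has at most [K] digits. *)
Lemma exec_agree M o o' K fuel q l h r t tr : (forall x, x < 2 ^ K -> o x = o' x) ->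
  size l + (size r).+1 + fuel <= K ->
  exec M o fuel q l h r t tr = exec M o' fuel q l h r t tr.
Proof.
move=> oo'; elim: fuel q l h r t tr => [|fuel IH] q l h r t tr le //=.
case: (lookup M q h) => // -[s d q'|qy qn].
  case E: (move d l s r) => [[l' h'] r']; apply: IH.
  by case: d l r le E => [] [|a l] [|b r] //= le [<- _ <-] /=; lia.
have lt : readnum 0 (h :: r) < 2 ^ K.
  apply: leq_trans (readnum_ub _ _) _; rewrite mul1n leq_exp2l //=; lia.
have /= -> := oo' _ lt; apply: IH; lia.
Qed.

Lemma peval_poly p : exists C, forall n, peval p n <= C * n.+1 ^ size p.
Proof.
elim: p => [|c p [C IH]]; first by exists 0.
exists (c + C) => n /=; have := IH n; rewrite expnS.
by have := expn_gt0 n.+1 (size p); nia.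
Qed.

Lemma expn_poly d : exists C, forall n, n.+1 ^ d <= C * 2 ^ n.
Proof.
case: d => [|d]; first by exists 1 => n; rewrite mul1n expn_gt0.
(* [n + 1 <= (q + 1)(d + 1) <= (d + 1) * 2 ^ q], and raising to the power [d + 1] turns [2 ^ q] into
   at most [2 ^ n]. *)
exists (d.+1 ^ d.+1) => n; set q := n %/ d.+1.
have le1 : n.+1 <= d.+1 * 2 ^ q.
  apply: leq_trans (_ : q.+1 * d.+1 <= _); first exact: ltn_ceil.
  by rewrite mulnC leq_pmul2l // ltn_expl.
apply: (leq_trans (_ : _ <= (d.+1 * 2 ^ q) ^ d.+1)); first by rewrite leq_exp2r.
by rewrite expnMn -expnM leq_pmul2l ?expn_gt0 // leq_exp2l // leq_divM.
Qed.

Lemma peval_exp p : exists C, forall n, peval p n <= C * 2 ^ n.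
Proof.
have [C HC] := peval_poly p; have [C' HC'] := expn_poly (size p).
exists (C * C') => n; apply: leq_trans (HC n) _.
by rewrite -mulnA leq_mul2l HC' orbT.
Qed.

(** Without a step the tape is unchanged, so the hypothesis is the first item of the data. *)
Lemma res_time0 M o x s out tr : res M o (x :: s) out 0 tr -> out = x /\
    lookup M 0 (head Bl (bin x)) = None.
Proof.
case=> tape [[fuel E] <-]; have [_] := exec_time E; rewrite subnn /= enc_cons.
have [c [w [Ex _]]] := bin_neq_nil x; rewrite Ex /=.
case El: (lookup M 0 c) => // -[<- _]; split=> //.
rewrite -[LHS]/(readnum 0 ((c :: w) ++ Hash :: enc s)) -Ex.
by rewrite readnum_stop ?bin_bits // bin_readnumK.
Qed.

Lemma res_lookup_None M o x s out t tr : lookup M 0 (head Bl (bin x)) = None ->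
  res M o (x :: s) out t tr -> t = 0.
Proof.
have [c [w [Ex _]]] := bin_neq_nil x; rewrite Ex /= => El [tape [[fuel]]].
by rewrite enc_cons Ex /=; case: fuel => [|fuel] /=; rewrite El => -[].
Qed.

Lemma sum_pos_lb (ts : nat -> nat) i : (forall j, 0 < j <= i -> 0 < ts j) ->
    i <= \sum_(j < i.+1) ts j.
Proof.
move=> ts_gt0; rewrite big_ord_recl; apply: leq_trans (leq_addl _ _).
rewrite -{1}[i]card_ord -sum1_card; apply: leq_sum => j _; apply: ts_gt0.
by rewrite /= /bump /= add1n ltn_ord.
Qed.

Lemma F_pad_not_PRT_O : ~ PRT_O F_pad.
Proof.
move=> [M [p learn]].
pose o0 x := x == 0.
have o0P : oracle_for o0 (F_pad 0) by move=> x; rewrite F_pad_zero; split=> /eqP.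
have f0_enum : is_enum (fun=> 0) (F_pad 0).
  by split=> [n|x /F_pad_zero ->]; [apply/F_pad_zero|exists 0].
have zeros_iseg (f : nat -> nat) j : (forall i, i < j -> f i = 0) -> iseg f j = nseq j 0.
  move=> f0; apply: (@eq_from_nth _ 0); rewrite size_mkseq ?size_nseq // => i lt.
  by rewrite nth_mkseq // nth_nseq lt f0.
(* On strings of zeros with the oracle of [{0}] the learner converges, so only finitely many
   hypotheses occur. *)
have [B HB] : exists B, forall j out t tr, res M o0 (nseq j 0) out t tr -> out < B.
  have [//|i [h [ts [qs [_ [Hle [Hge _]]]]]]] := learn 0 _ _ f0_enum _ o0P.
  have [B HB] : exists B, forall j out t tr, j < i -> res M o0 (nseq j 0) out t tr -> out < B.
    elim: i {Hge} Hle => [|i IH] Hle; first by exists 0.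
    have [|B HB] := IH; first by move=> j le; apply: Hle; lia.
    have [|out [tr [r _]]] := Hle i; first by lia.
    exists (maxn B out.+1) => j out' t' tr'; rewrite ltnS leq_eqVlt => /orP[/eqP->|lt] r'.
      by rewrite zeros_iseg // in r; have [-> _ _] := res_fun r' r; rewrite leq_maxr.
    by rewrite leq_max (HB _ _ _ _ lt r').
  exists (maxn B h.+1) => j out t tr r; case: (ltnP j i) => lt.
    by rewrite leq_max (HB _ _ _ _ lt r).
  have [t' [tr' r']] := Hge j lt; rewrite zeros_iseg // in r'.
  by have [-> _ _] := res_fun r r'; rewrite leq_maxr.
have [C HC] := peval_exp p.
(* [n] has to exceed [B] for the final contradiction, and to be large against [C] for
   [K <= n * 2 ^ n <= 2 ^ (2n)]. *)
pose m := B + (3 * C + 3); set n := ones m.+1.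
have le_mn : m < n by exact: ones_ge.
(* Room for [p n] zeros, coded in two cells each, and [p n] steps. *)
pose K := 3 * peval p n + 3.
have le_K : K <= 2 ^ n.*2.
  apply: leq_trans (_ : n * 2 ^ n <= _).
    by have := HC n; have := expn_gt0 2 n; rewrite /K; nia.
  by rewrite -addnn expnD leq_pmul2r ?expn_gt0 // ltnW // ltn_expl.
pose J := (peval p n).+1.
have [||f [f_enum fJ]] := @enum_prefix (nseq J 0) 0 (F_pad n).
- by move=> x /nseqP[-> _]; apply: F_pad_zero_in.
- exact: F_pad_zero_in.
rewrite size_nseq in fJ.
have f0 i : i < J -> f i = 0.
  by move=> lt; have := congr1 (nth 0 ^~ i) fJ; rewrite nth_mkseq // nth_nseq lt.
pose o x : bool := if excluded_middle_informative (F_pad n x) then true else false.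
have oP : oracle_for o (F_pad n) by move=> x; rewrite /o; case: excluded_middle_informative.
(* A nonzero member of the target ends in at least [2 ^ (2n) >= K] zeros, so it is at least
   [2 ^ K]. *)
have oo0 x : x < 2 ^ K -> o x = o0 x.
  move=> lt; rewrite /o /o0; case: excluded_middle_informative => /= Fx; last first.
    by case: eqP => // x0; case: Fx; rewrite x0; apply: F_pad_zero_in.
  have [//|/(F_pad_big Fx)[k [E le]]] := posnP x.
  have lb : 2 ^ k.+1 <= x.
    rewrite -[x]bin_readnumK E.
    have H acc w v : all is_bit w -> readnum acc (w ++ v) = readnum (readnum acc w) v.
      by elim: w acc => [|[] w IH] acc //= wb; apply: IH.
    rewrite H ?all_nseq ?orbT // readnum_zeros leq_pmull //.
    exact: readnum_One_gt0.
  have : 2 ^ K <= 2 ^ k.+1 by rewrite leq_exp2l // (leq_trans le_K).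
  by move=> le2; move: lt; rewrite ltnNge (leq_trans le2 lb).
have [i [h [ts [qs [Fh [Hle [Hge [lt_t _]]]]]]]] := learn n (@F_pad_min_index m) f f_enum o oP.
have le_nh : n <= h by rewrite leqNgt; apply/negP => /(@F_pad_min_index m); apply.
have iseg_S j : 0 < j -> exists s, iseg f j = 0 :: s.
  by case: j => // j _; exists (behead (iseg f j.+1)); rewrite /iseg /mkseq /= f0.
(* If no step were made on some string starting with 0, none would be made on any such string, and
   the final hypothesis would be 0, below [n]. *)
have ts_gt0 j : 0 < j <= i -> 0 < ts j.
  case/andP=> j_gt0 le; rewrite lt0n; apply/eqP => ts0.
  have [out [tr [r _]]] := Hle j le; have [s Es] := iseg_S j j_gt0.
  rewrite ts0 Es in r; have [_ El] := res_time0 r.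
  have [t [tr' r']] := Hge i (leqnn i); have [|s' Es'] := iseg_S i; first by lia.
  rewrite Es' in r'; have t0 := res_lookup_None El r'; rewrite t0 in r'.
  by have [h0 _] := res_time0 r'; rewrite h0 in le_nh; lia.
(* Each stage from 1 to [i] costs a step, so convergence falls within the initial zeros. *)
have lt_i : i < J by have := sum_pos_lb ts_gt0; rewrite /J; lia.
have [out [tr [r _]]] := Hle i (leqnn i); have [t' [tr' r']] := Hge i (leqnn i).
have [Eo _ _] := res_fun r r'; rewrite Eo zeros_iseg in r; last by move=> j lt; apply: f0; lia.
have lt_ts : ts i < peval p n by apply: leq_ltn_trans lt_t; rewrite big_ord_recr leq_addl.
have [tape [[fuel E] Eh]] := r.
(* The run at stage [i] asks only below [2 ^ K], so it is also a run for the target [{0}]; its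
   hypothesis is then below [B], although it is at least [n]. *)
have [_] := exec_time E; rewrite subn0 (@exec_agree M o o0 K _ _ _ _ _ _ _ oo0); last first.
  have -> : enc (nseq i 0) = flatten (nseq i [:: Zero; Hash]) by rewrite /enc map_nseq.
  rewrite size_behead size_flatten /shape map_nseq sumn_nseq /K /=; lia.
move=> E0; have: h < B by apply: (HB i h (ts i) tr); exists tape; split=> //; exists (ts i).
by lia.
Qed.

(** * Inclusions *)

(* [extract] reduces the code of a data string and a transcript to the data
   string, leaving blanks elsewhere: the length at the front is used as a counter,
   and a blank in place of a separator marks the end of the items counted so far.
   It ends in state 15. *)
Definition extract : TM :=
  [:: (0, Zero, Wr Zero Rgt 0); (0, One, Wr One Rgt 0); (0, Hash, Wr Bl Lft 1);
      (1, Zero, Wr One Lft 1); (1, One, Wr Zero Rgt 2); (1, Bl, Wr Bl Rgt 13);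
      (2, One, Wr One Rgt 2); (2, Bl, Wr Bl Rgt 3);
      (3, Zero, Wr Zero Rgt 3); (3, One, Wr One Rgt 3); (3, Hash, Wr Bl Lft 4);
      (4, Zero, Wr Zero Lft 4); (4, One, Wr One Lft 4); (4, Hash, Wr Hash Lft 4);
      (4, Bl, Wr Bl Lft 5);
      (5, Zero, Wr One Lft 5); (5, One, Wr Zero Rgt 6); (5, Bl, Wr Bl Rgt 8);
      (6, One, Wr One Rgt 6); (6, Bl, Wr Bl Rgt 7);
      (7, Zero, Wr Zero Rgt 7); (7, One, Wr One Rgt 7); (7, Hash, Wr Hash Rgt 7);
      (7, Bl, Wr Hash Rgt 3);
      (8, One, Wr Bl Rgt 8); (8, Bl, Wr Bl Rgt 9);
      (9, Zero, Wr Zero Rgt 9); (9, One, Wr One Rgt 9); (9, Hash, Wr Hash Rgt 9);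
      (9, Bl, Wr Hash Rgt 10);
      (10, Zero, Wr Bl Rgt 10); (10, One, Wr Bl Rgt 10); (10, Hash, Wr Bl Rgt 10);
      (10, Bl, Wr Bl Lft 11);
      (11, Bl, Wr Bl Lft 11); (11, Hash, Wr Hash Lft 12);
      (12, Zero, Wr Zero Lft 12); (12, One, Wr One Lft 12); (12, Hash, Wr Hash Lft 12);
      (12, Bl, Wr Bl Rgt 15);
      (13, One, Wr Bl Rgt 13); (13, Bl, Wr Bl Rgt 14);
      (14, Zero, Wr Bl Rgt 14); (14, One, Wr Bl Rgt 14); (14, Hash, Wr Bl Rgt 14);
      (14, Bl, Wr Bl Stay 15)].

Definition shift_action (a : action) : action :=
  match a with
  | Wr s d q => Wr s d (q + 15)
  | Ask qy qn => Ask (qy + 15) (qn + 15)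
  end.

(** The final state 15 of [extract] becomes the start state of [T]. *)
Definition extract_then (T : TM) : TM :=
  extract ++ [seq (e.1.1 + 15, e.1.2, shift_action e.2) | e <- T].

Lemma lookup_cat M M' q s :
  lookup (M ++ M') q s = if lookup M q s is Some a then Some a else lookup M' q s.
Proof. by elim: M => //= -[[q' s'] a] M IH; case: ifP. Qed.

Lemma lookup_shift T q s :
  lookup [seq (e.1.1 + 15, e.1.2, shift_action e.2) | e <- T] q s =
  if 15 <= q then omap shift_action (lookup T (q - 15) s) else None.
Proof.
elim: T => [|[[q' s'] a] T IH] /=; first by case: ifP.
rewrite IH (_ : (q' + 15 == q) = (15 <= q) && (q' == q - 15)); last by lia.
by case: (15 <= q) => //=; case: ifP.
Qed.

Lemma lookup_extract q s : 15 <= q -> lookup extract q s = None.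
Proof. by do 15![case: q => [//|q]]. Qed.

Lemma lookup_extract_then T q s :
  lookup (extract_then T) (q + 15) s = omap shift_action (lookup T q s).
Proof. by rewrite lookup_cat lookup_extract ?leq_addl // lookup_shift leq_addl addnK. Qed.

Lemma oracle_free_extract_then T : oracle_free T -> oracle_free (extract_then T).
Proof.
move=> oT q s qy qn; rewrite lookup_cat.
case E: (lookup extract q s) => [a|].
  by case=> Ea; move: E; rewrite Ea; apply: (@oracle_freeI extract).
rewrite lookup_shift; case: ifP => // _.
by case E': (lookup T (q - 15) s) => [[]|] //= _; apply: (oT _ _ _ _ E').
Qed.

(** Blanks beyond both ends are what [T] would find there anyway; they can only add blanks to the
    final tape. *)
Lemma exec_shift T M o fuel q l h r t tr tape t' tr' a b t0 tr0 :
  (forall q s, lookup M (q + 15) s = omap shift_action (lookup T q s)) -> oracle_free T ->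
  exec T o fuel q l h r t tr = Some (tape, t', tr') ->
  exists b' t1 tr1,
    exec M o fuel (q + 15) (l ++ nseq a Bl) h (r ++ nseq b Bl) t0 tr0
    = Some (tape ++ nseq b' Bl, t1, tr1).
Proof.
move=> HM oT; elim: fuel q l h r t tr a b t0 tr0 => [|fuel IH] q l h r t tr a b t0 tr0 /=;
  rewrite HM.
  by case: (lookup T q h) => //= -[<- _ _]; exists b, t0, tr0.
case E: (lookup T q h) => [[s d q'|qy qn]|] /=.
- case: d {E} => /=.
  (* At the end of its tape the padded run uses up one of its blanks, or creates one if none is
     left. *)
  + by case: l => [|x l] /IH H; [case: a => [|a]; [apply: (H 0 b)|apply: (H a b)]|apply: H].
  + by case: r => [|x r] /IH H; [case: b => [|b]; [apply: (H a 0)|apply: (H a b)]|apply: H].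
  + by move/IH; apply.
- by case: (oT _ _ _ _ E).
- by case=> <- _ _; exists b, t0, tr0.
Qed.

Lemma cval_rev w : all is_bit w -> cval One (rev w) = readnum 0 w.
Proof.
elim/last_ind: w => // w s IH; rewrite all_rcons => /andP[sb wb].
have [b ->] : exists b, s = bit b by case: s sb => // _; [exists false|exists true].
by rewrite rev_rcons /= IH // readnum_rcons //; case: b.
Qed.

Section Extract.
Variables (T : TM) (o : nat -> bool).
Let X := extract_then T.

Lemma rev_map_const (s : sym) (w : seq sym) : rev (map (fun=> s) w) = nseq (size w) s.
Proof. by elim: w => // a w IH; rewrite /= rev_cons IH -cats1 nseq_cons cats0. Qed.

Lemma nonblank_cat_bin w x : all nonblank w -> all nonblank (w ++ bin x).
Proof. by move=> w_nb; rewrite all_cat w_nb bits_nonblank // bin_bits. Qed.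

Lemma extract_mark c w x s : all nonblank w ->
  leads X o (cr 3 (rev w ++ Bl :: c) (enc (x :: s))) (cl 5 c (Bl :: (w ++ bin x) ++ Bl :: enc s)).
Proof.
move=> /(nonblank_cat_bin x) W_nb; rewrite enc_cons.
eapply leads_step; first by apply: skipR => u /(allP (bin_bits x)); case: u.
step_crL; rewrite catA -rev_cat.
eapply leads_step; first by apply: skipL => u; rewrite mem_rev => /(allP W_nb); case: u.
by step_clL; rewrite revK; exact: leads_refl.
Qed.

(** [w] holds the finished items and [c] counts those still to be kept after [x]. While the counter
    is visited, the blanked separator of [x] marks the place of return; at value 0 the counter and
    [ys] are erased. *)
Lemma extract_loop s c w x ys : all (mem [:: One; Zero]) c -> cval One c = size s ->
  all nonblank w ->
  exists a b, leads X o (cr 3 (rev w ++ Bl :: c) (enc (x :: s ++ ys)))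
                        (cr 15 (nseq a Bl) (w ++ enc (x :: s) ++ nseq b Bl)).
Proof.
elim: s c w x => [|y s IH] c w x dc Ec w_nb.
all: have H1 := fun s' => extract_mark c x s' w_nb.
all: have W_nb := nonblank_cat_bin x w_nb.
all: move: H1 W_nb; set W := w ++ bin x => H1 W_nb.
- have Ec0 := cval0 (d1 := One) (d0 := Zero) isT dc Ec; set k := size c in Ec0.
  exists (k.+2), (size (enc ys)).+1; apply: leads_trans (H1 _) _.
  rewrite Ec0 -{1}[nseq k Zero]cats0.
  eapply leads_step; first by apply: (sweepL (fun=> One)) => u /nseqP[->].
  rewrite map_nseq rev_nseq; step_clR.
  eapply leads_step; first by apply: (sweepR (fun=> Bl)) => u /nseqP[->].
  step_crR.
  eapply leads_step; first by apply: skipR => u /(allP W_nb); case: u.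
  step_crR; rewrite -{1}[enc ys]cats0.
  eapply leads_step.
    by apply: (sweepR (fun=> Bl)) => u /(allP (enc_nonblank _)); case: u.
  step_crL.
  rewrite rev_map_const.
  eapply leads_step; first by apply: skipL => u /nseqP[->].
  step_clL.
  eapply leads_step; first by apply: skipL => u; rewrite mem_rev => /(allP W_nb); case: u.
  step_clR.
  rewrite revK rev_nseq map_nseq rev_nseq !nseq_cons !cats0 enc_cons /W -!catA.
  exact: leads_refl.
- have [k [c' [Ecc Ev dc']]] := cval_pred (d1 := One) (d0 := Zero) isT dc Ec.
  have W'_nb : all nonblank (rcons W Hash) by rewrite all_rcons.
  have [a [b H]] := IH _ (rcons W Hash) y dc' Ev W'_nb.
  exists a, b; apply: leads_trans (H1 _) _.
  have -> : w ++ enc (x :: y :: s) ++ nseq b Bl = rcons W Hash ++ enc (y :: s) ++ nseq b Bl.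
    by rewrite (enc_cons x) cat_rcons /W -(catA w) -(catA (bin x)) cat_cons.
  apply: leads_trans H; rewrite Ecc.
  eapply leads_step; first by apply: (sweepL (fun=> One)) => u /nseqP[->].
  rewrite map_nseq rev_nseq; step_clR.
  eapply leads_step; first by apply: skipR => u /nseqP[->].
  step_crR.
  eapply leads_step; first by apply: skipR => u /(allP W_nb); case: u.
  by step_crR; rewrite rev_nseq rev_rcons; exact: leads_refl.
Qed.

Lemma extract_run s ys : exists a b,
  leads X o (cr 0 [::] (enc (size s :: s ++ ys))) (cr 15 (nseq a Bl) (enc s ++ nseq b Bl)).
Proof.
set n := size s; rewrite enc_cons.
have db : all is_bit (bin n) := bin_bits n.
have dc : all (mem [:: One; Zero]) (rev (bin n)).
  by rewrite all_rev; apply: sub_all db => -[].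
have Ec : cval One (rev (bin n)) = n by rewrite cval_rev // bin_readnumK.
have H1 : leads X o (cr 0 [::] (bin n ++ Hash :: enc (s ++ ys))) (cl 1 (rev (bin n))
    (Bl :: enc (s ++ ys))).
  eapply leads_step; first by apply: skipR => u /(allP db); case: u.
  by step_crL; rewrite cats0; exact: leads_refl.
case: s @n db dc Ec H1 => [|x s] n db dc Ec H1.
  (* The three further blanks are the cell left of the counter, its only digit and its separator. *)
  exists (size (enc ys) + 3), 1; apply: leads_trans H1 _.
  step_clL; step_clR; step_crR; step_crR; rewrite -{1}[enc ys]cats0.
  eapply leads_step.
    by apply: (sweepR (fun=> Bl)) => u /(allP (enc_nonblank _)); case: u.
  step_crS; rewrite rev_map_const nseqD.
  exact: leads_refl.
have [k [c' [Ecc Ev dc']]] := cval_pred (d1 := One) (d0 := Zero) isT dc Ec.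
have [a [b H]] := @extract_loop s _ [::] x ys dc' Ev isT.
exists a, b; apply: leads_trans H1 _; apply: leads_trans H; rewrite Ecc.
eapply leads_step; first by apply: (sweepL (fun=> One)) => u /nseqP[->].
rewrite map_nseq rev_nseq; step_clR.
eapply leads_step; first by apply: skipR => u /nseqP[->].
by step_crR; rewrite rev_nseq; exact: leads_refl.
Qed.

End Extract.

Lemma teachO_extract_then T s tr tau : oracle_free T -> res_seq T s tau ->
  teachO (extract_then T) s tr tau.
Proof.
move=> oT [tape [t [tq [rest [[fuel E] Et]]]]].
have [a [b [n H]]] := extract_run T (fun=> false) s (flatten [seq [:: x.1; nat_of_bool x.2]
    | x <- tr]).
(* If [enc s] is empty, a padding blank, if present, becomes the scanned cell. *)
have [c Ec] : exists c, cr 15 (nseq a Bl) (enc s ++ nseq b Bl) =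
    (0 + 15, [::] ++ nseq a Bl, head Bl (enc s), behead (enc s) ++ nseq c Bl).
  by rewrite /cr; case: (enc s) => [|y e]; [case: b {H} => [|b]; [exists 0|exists b]|exists b].
have [b' [t1 [tr1 E']]] := exec_shift a c (0 + n) [::] (lookup_extract_then T) oT E.
exists (tape ++ nseq b' Bl), t1, tr1, (rest ++ nseq b' Bl); split.
  by exists (n + fuel); have HX := H fuel 0 [::]; rewrite Ec in HX; exact: etrans HX E'.
by rewrite -cat_cons catA -Et -!catA nseq_cons cats0.
Qed.

Lemma extract_then_teacher T : teacher T -> teacherO (extract_then T) /\
  forall s tr tau, res_seq T s tau -> teachO (extract_then T) s tr tau.
Proof.
move=> [oT [T_total [T_mono T_sub]]].
have TX s tr tau : res_seq T s tau -> teachO (extract_then T) s tr tau.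
  exact: teachO_extract_then.
have XT s tr tau : teachO (extract_then T) s tr tau -> res_seq T s tau.
  by have [tau' H] := T_total s => /(res_seq_fun (TX _ tr _ H)) <-.
split=> //; split; first exact: oracle_free_extract_then.
split=> [s tr|]; first by have [tau H] := T_total s; exists tau; apply: TX.
split=> [s s' tr tr' tau tau' /XT H /XT H' pre _|s tr tau /XT]; first exact: T_mono H H' pre.
exact: T_sub.
Qed.

(** The teacher works on the data alone, so the transcripts can be accumulated afterwards from the
    runs of [M], which halt at every stage because [M] converges. *)
Lemma PRT_TO_intro F M T p : teacher T ->
  (forall k, min_index F k -> forall f, is_enum f (F k) -> forall o, oracle_for o (F k) ->
     exists D, (forall n, res_seq T (iseg f n) (D n)) /\
       conv_within M o F (F k) D (peval p k)) -> PRT_TO F.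
Proof.
move=> /extract_then_teacher[XT TX] learn.
exists M, (extract_then T), p; split=> // k k_min f f_enum o o_k.
have [D [TD conv]] := learn k k_min f f_enum o o_k.
have M_total n : exists tr, exists out t, res M o (D n) out t tr.
  have [i [h [ts [qs [_ [Hle [Hge _]]]]]]] := conv.
  case: (leqP n i) => [/Hle[out [tr [r _]]]|/ltnW/Hge[t [tr r]]].
    by exists tr, out, (ts n).
  by exists tr, h, t.
pose q n := proj1_sig (constructive_indefinite_description _ (M_total n)).
have qP n : exists out t, res M o (D n) out t (q n).
  exact: proj2_sig (constructive_indefinite_description _ (M_total n)).
pose fix Tr n := if n is n'.+1 then Tr n' ++ q n' else [::].
exists D, Tr; split=> //; split=> // n; split; first exact: TX.
by have [out [t r]] := qP n; exists out, t, (q n).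
Qed.

(** * Learners without queries, and the identity teacher *)

Lemma oracle_free_exec M o o' fuel q l h r t tr : oracle_free M ->
  exec M o fuel q l h r t tr = exec M o' fuel q l h r t tr.
Proof.
move=> oM; elim: fuel q l h r t tr => //= fuel IH q l h r t tr.
case E: (lookup M q h) => [[s d q'|qy qn]|] //; last by case: (oM _ _ _ _ E).
by case: (move d l s r) => -[l' h'] r'.
Qed.

Lemma oracle_free_res M o o' s out t tr : oracle_free M ->
  res M o s out t tr -> res M o' s out t tr.
Proof.
move=> oM [tape [[fuel E] Eo]]; exists tape; split=> //; exists fuel.
by rewrite (oracle_free_exec o' o).
Qed.

Lemma oracle_free_conv M o o' F A D b : oracle_free M ->
  conv_within M o F A D b -> conv_within M o' F A D b.
Proof.
move=> oM [i [h [ts [qs [Fh [Hle [Hge lt]]]]]]].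
exists i, h, ts, qs; split=> //; split=> [j /Hle[out [tr [r Eq]]]|].
  by exists out, tr; split=> //; apply: oracle_free_res r.
by split=> // j /Hge[t [tr r]]; exists t, tr; apply: oracle_free_res r.
Qed.

(** The empty table halts at once. On the empty string the scanned blank stays on the tape, whence
    the two values of [rest]. *)
Lemma id_res s : res_seq [::] s s.
Proof.
apply: (@res_seq_leads [::] s s 0 [::] (enc s) (if s is [::] then [:: Bl] else [::])) => //.
  exact: leads_refl.
by case: s => // x s; have [c [w [-> _ _]]] := enc_start x s.
Qed.

Lemma id_teacher : teacher [::].
Proof.
split=> //; split; first by move=> s; exists s; apply: id_res.
split=> [s s' tau tau' H H'|s tau H].
  by rewrite (res_seq_fun H (id_res s)) (res_seq_fun H' (id_res s')).
by rewrite (res_seq_fun H (id_res s)).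
Qed.

Lemma PRT_sub_PRT_O F : PRT F -> PRT_O F.
Proof.
move=> [M [p [oM learn]]]; exists M, p => k k_min f f_enum o _.
exact: oracle_free_conv (learn k k_min f f_enum).
Qed.

Lemma PRT_sub_PRT_T F : PRT F -> PRT_T F.
Proof.
move=> [M [p [oM learn]]]; exists M, [::], p; split=> //; split; first exact: id_teacher.
move=> k k_min f f_enum; exists (iseg f); split=> [n|]; first exact: id_res.
exact: learn.
Qed.

Lemma PRT_O_sub_PRT_TO F : PRT_O F -> PRT_TO F.
Proof.
move=> [M [p learn]]; apply: (@PRT_TO_intro F M [::] p id_teacher) => k k_min f f_enum o o_k.
by exists (iseg f); split=> [n|]; [apply: id_res|apply: learn].
Qed.

Lemma PRT_T_sub_PRT_TO F : PRT_T F -> PRT_TO F.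
Proof.
move=> [M [T [p [oM [tT learn]]]]]; apply: (@PRT_TO_intro F M T p tT) => k k_min f f_enum o o_k.
have [D [TD conv]] := learn k k_min f f_enum.
by exists D; split=> //; apply: oracle_free_conv conv.
Qed.

Theorem theorem3p11 :
  (strict_incl PRT PRT_O /\ strict_incl PRT_O PRT_TO) /\
  (strict_incl PRT PRT_T /\ strict_incl PRT_T PRT_TO) /\
  not_incl PRT_O PRT_T /\
  not_incl PRT_T PRT_O.
Proof.
have F_run_indexed : indexed_family F_run by exists E_run; split; first exact: oracle_freeI.
have F_pad_indexed : indexed_family F_pad by exists E_pad; split; first exact: oracle_freeI.
(* PRT lies inside both PRT[T] and PRT[O], so each failure there carries over to PRT. *)
have F_run_not_PRT : ~ PRT F_run by move/PRT_sub_PRT_T/F_run_not_PRT_T.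
have F_pad_not_PRT : ~ PRT F_pad by move/PRT_sub_PRT_O/F_pad_not_PRT_O.
have F_run_PRT_TO := PRT_O_sub_PRT_TO F_run_PRT_O.
have F_pad_PRT_TO := PRT_T_sub_PRT_TO F_pad_PRT_T.
split; [split|split; [split|split]].
- by split=> [F _|]; [apply: PRT_sub_PRT_O|exists F_run; split=> //; split=> //;
    apply: F_run_PRT_O].
- by split=> [F _|]; [apply: PRT_O_sub_PRT_TO|exists F_pad; split=> //; split=> //;
    apply: F_pad_not_PRT_O].
- by split=> [F _|]; [apply: PRT_sub_PRT_T|exists F_pad; split=> //; split=> //;
    apply: F_pad_PRT_T].
- by split=> [F _|]; [apply: PRT_T_sub_PRT_TO|exists F_run; split=> //; split=> //;
    apply: F_run_not_PRT_T].
- by exists F_run; split=> //; split; [apply: F_run_PRT_O|apply: F_run_not_PRT_T].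
- by exists F_pad; split=> //; split; [apply: F_pad_PRT_T|apply: F_pad_not_PRT_O].
Qed.
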